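(* Let $L_D$ be a virtual link diagram with $n$ components. For a commutative unital ring $R$ let $H(\mathcal F_{\mathrm{Lee}}(L_D),R)$ denote the total homology (direct sum over all homology degrees) of the virtual Lee complex $\mathcal F_{\mathrm{Lee}}(L_D)$ of $L_D$ with coefficients in $R$. Then: (a) If $R=\mathbb Z$, there is an isomorphism $$H(\mathcal F_{\mathrm{Lee}}(L_D),\mathbb Z)\cong\bigoplus_{2^n}\mathbb Z\;\oplus\;\mathrm{Tor},$$ where $\mathrm{Tor}$ consists of torsion elements. (b) If $R=\mathbb Q$ or $R=\mathbb Z\left[\tfrac12\right]$, there is an isomorphism of $R$-modules $$H(\mathcal F_{\mathrm{Lee}}(L_D),R)\cong\bigoplus_{2^n}R .$$ (c) The only possible torsion in $H(\mathcal F_{\mathrm{Lee}}(L_D),\mathbb Z)$ is $2$-torsion, i.e. every torsion element has order a power of $2$.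
   Context: **Virtual link diagrams.** A virtual link diagram is a finite four-valent graph embedded in $\mathbb R^2$ (circles, i.e. closed edges without vertices, are allowed), each vertex being marked either as a classical crossing (with over/under information) or as a virtual crossing. Its components are the closed curves obtained by going straight through every vertex (including vertex-free circles); $n$ is their number. Diagrams are oriented (every component carries an orientation); $n_-$ is the number of negative classical crossings. **Resolutions.** Rotate a classical crossing so that the overstrand runs from bottom left to top right. Its $0$-resolution is $)($ (two vertical strings, left and right) and its $1$-resolution consists of two horizontal strings, bottom and top. With $N$ ordered classical crossings and $a\in\{0,1\}^N$, the resolution $\gamma_a$ is obtained by performing the $a_i$-resolution at the $i$-th classical crossing, keeping all virtual crossings. It is a collection of closed curves (going straight through virtual crossings), called v-circles. Put $|a|=\sum_i a_i$. For every $a$ choose a numbering of the v-circles of $\gamma_a$ and an orientation of each v-circle. **Algebra.** Let $A=R[X]/(X^2=1)$, free with basis $1,X$, and define $R$-linear maps - $m\colon A\otimes A\to A$: $1\otimes1\mapsto1$, $1\otimes X\mapsto X$, $X\otimes1\mapsto X$, $X\otimes X\mapsto1$; - $\Delta\colon A\to A\otimes A$: $1\mapsto1\otimes X+X\otimes1$, $X\mapsto1\otimes1+X\otimes X$; - $\Phi\colon A\to A$: $1\mapsto1$, $X\mapsto -X$; - $\theta\colon A\to A$: $\theta=0$. **The complex $\mathcal F_{\mathrm{Lee}}(L_D)$.** If $\gamma_a$ has $c$ v-circles, assign to it $A^{\otimes c}$, one factor per v-circle, ordered by the numbering. The module in homology degree $i-n_-$ is the direct sum of these modules over all $a$ with $|a|=i$.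 If $a,a'$ agree except at one position $r$, where $a_r=0$, $a'_r=1$, there is a component of the differential from the module of $\gamma_a$ to that of $\gamma_{a'}$ defined below; all other components are zero. The change from $\gamma_a$ to $\gamma_{a'}$ (a saddle at crossing $r$) either merges two v-circles into one (multiplication), splits one v-circle into two (comultiplication), or keeps the number of v-circles (non-orientable saddle). *Non-orientable saddle:* the component is $0$ (it is induced by $\theta=0$). *Decorations of orientable saddles.* With the crossing rotated so that the overstrand runs from bottom left to top right (this rotation is unique up to rotation by $180^\circ$), the standard local orientation is: left string down, right string up in the $0$-resolution; bottom string to the right, top string to the left in the $1$-resolution (it is invariant under the $180^\circ$ rotation). Each v-circle of $\gamma_a$ or $\gamma_{a'}$ involved in an orientable saddle has its string(s) at the crossing either all oriented in the standard way or all in the opposite way. The unsigned map is $m$ (resp. $\Delta$) applied to the factors of the involved v-circles, pre-/post-composed with $\Phi$ on each factor belonging to an involved v-circle that is not standardly oriented. On the factor of each v-circle not involved in the saddle the map is the identity if the chosen orientations of this v-circle in $\gamma_a$ and $\gamma_{a'}$ agree and $\Phi$ otherwise. *Signs.* For each classical crossing fix one of its two rotated positions, and place the x-marker on the left string of its $0$-resolution and on the bottom string of its $1$-resolution. For a multiplication with upper v-circles $C_x$ (carrying the x-marker) and $C_y$, lower v-circle $D$, and uninvolved v-circles $E_1,\dots,E_s$ (listed in some fixed order), let $\sigma_1$ be the permutation comparing the numbering of $\gamma_a$ with the order $(C_x,C_y,E_1,\dots,E_s)$ and $\sigma_2$ the permutation comparing the numbering of $\gamma_{a'}$ with the order $(D,E_1,\dots,E_s)$.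 For a comultiplication with upper v-circle $D$ and lower v-circles $C_x$ (carrying the x-marker), $C_y$, use the orders $(D,E_1,\dots,E_s)$ for $\gamma_a$ and $(C_x,C_y,E_1,\dots,E_s)$ for $\gamma_{a'}$. The component of the differential is the unsigned map multiplied by $\operatorname{sgn}(\sigma_1)\operatorname{sgn}(\sigma_2)$. With these conventions all faces of the cube anticommute, so this is a chain complex (the differential raises the homology degree by one); different choices of orderings, numberings, orientations and positions give isomorphic complexes.
   Formalization: The standard local orientation of the 1-resolution is reversed: bottom string to the left, top string to the right, matching the 0-resolution at the end points; with the stated orientation faces need not anticommute (unknot with two positive kinks), so the homology would be undefined. *)

(* Defs.v *)
From HB Require Import structures.
From mathcomp Require Import all_boot all_order all_algebra.
From mathcomp Require Import perm generic_quotient ring_quotient.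
From mathcomp Require Import boolp.

Set Implicit Arguments.
Unset Strict Implicit.
Unset Printing Implicit Defensive.

Import GRing.Theory.
Local Open Scope ring_scope.

Section Homology.
Variables (R : pzRingType) (U V W : lmodType R).
Variables (f : {linear U -> V}) (g : {linear V -> W}).

Definition cycle_pred : {pred V} := [pred x | g x == 0].

Fact cycle_closed : GRing.submod_closed cycle_pred.
Proof.
split=> [|a x y]; rewrite !inE ?linear0 // => /eqP gx /eqP gy.
by rewrite linearP gx gy scaler0 addr0.
Qed.
HB.instance Definition _ := GRing.isSubmodClosed.Build R V cycle_pred cycle_closed.

Record cycles := Cycle { cycle_val : V; _ : cycle_val \in cycle_pred }.
HB.instance Definition _ := [isSub for cycle_val].
HB.instance Definition _ := [Choice of cycles by <:].
HB.instance Definition _ := [SubChoice_isSubLmodule of cycles by <:].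

(* When g \o f = 0 this is the whole image of f. *)
Definition boundaries : {pred cycles} :=
  fun x => `[< exists y : U, f y = cycle_val x >].

Fact boundaries_closed : GRing.submod_closed boundaries.
Proof.
split=> [|a x y]; rewrite !unfold_in.
  by apply/asboolP; exists 0; rewrite linear0.
move=> /asboolP[u fu] /asboolP[v fv].
by apply/asboolP; exists (a *: u + v); rewrite linearP fu fv.
Qed.
HB.instance Definition _ :=
  GRing.isSubmodClosed.Build R cycles boundaries boundaries_closed.

Definition homology := Quotient.quot boundaries.
HB.instance Definition _ := GRing.Zmodule.on homology.

Local Open Scope quotient_scope.

Definition homology_scale (a : R) (x : homology) : homology :=
  \pi_homology (a *: repr x).

Fact homology_pi_scale a (x : cycles) :
  homology_scale a (\pi_homology x) = \pi_homology (a *: x).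
Proof.
apply/eqP; rewrite -Quotient.idealrBE -scalerBr rpredZ //.
by rewrite Quotient.idealrBE reprK.
Qed.

Fact homology_piD (x y : cycles) :
  \pi_homology (x + y) = \pi_homology x + \pi_homology y.
Proof. exact: Quotient.pi_add. Qed.

Fact homology_piP (x : homology) : exists u, x = \pi_homology u.
Proof. by exists (repr x); rewrite reprK. Qed.

Fact homology_scaleA a b x :
  homology_scale a (homology_scale b x) = homology_scale (a * b) x.
Proof.
have [u ->] := homology_piP x.
by rewrite (homology_pi_scale b) (homology_pi_scale a)
  (homology_pi_scale (a * b)) scalerA.
Qed.
Fact homology_scale1 : left_id 1 homology_scale.
Proof.
by move=> x; have [u ->] := homology_piP x; rewrite homology_pi_scale scale1r.
Qed.
Fact homology_scaleDr : right_distributive homology_scale +%R.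
Proof.
move=> a x y; have [u ->] := homology_piP x; have [v ->] := homology_piP y.
rewrite -homology_piD (homology_pi_scale a (u + v)) (homology_pi_scale a u).
by rewrite (homology_pi_scale a v) scalerDr homology_piD.
Qed.
Fact homology_scaleDl x : {morph homology_scale^~ x : a b / a + b}.
Proof.
move=> a b; have [u ->] := homology_piP x; rewrite (homology_pi_scale (a + b)).
by rewrite (homology_pi_scale a) (homology_pi_scale b) scalerDl homology_piD.
Qed.
HB.instance Definition _ := GRing.Zmodule_isLmodule.Build R homology
  homology_scaleA homology_scale1 homology_scaleDr homology_scaleDl.

End Homology.


Section DirectSum.
Variables (R : pzRingType) (I : finType) (M : I -> lmodType R).

Definition dirsum := {dffun forall i : I, M i}.
HB.instance Definition _ := Choice.on dirsum.

Definition dirsum_zero : dirsum := [ffun i : I => 0 : M i].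
Definition dirsum_opp (x : dirsum) : dirsum := [ffun i : I => - x i].
Definition dirsum_add (x y : dirsum) : dirsum := [ffun i : I => x i + y i].
Definition dirsum_scale (a : R) (x : dirsum) : dirsum := [ffun i : I => a *: x i].

Fact dirsum_addA : associative dirsum_add.
Proof. by move=> x y z; apply/ffunP => i; rewrite !ffunE addrA. Qed.
Fact dirsum_addC : commutative dirsum_add.
Proof. by move=> x y; apply/ffunP => i; rewrite !ffunE addrC. Qed.
Fact dirsum_add0 : left_id dirsum_zero dirsum_add.
Proof. by move=> x; apply/ffunP => i; rewrite !ffunE add0r. Qed.
Fact dirsum_addN : left_inverse dirsum_zero dirsum_opp dirsum_add.
Proof. by move=> x; apply/ffunP => i; rewrite !ffunE addNr. Qed.
HB.instance Definition _ := GRing.isZmodule.Build dirsum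
  dirsum_addA dirsum_addC dirsum_add0 dirsum_addN.

Fact dirsum_scaleA a b x :
  dirsum_scale a (dirsum_scale b x) = dirsum_scale (a * b) x.
Proof. by apply/ffunP => i; rewrite !ffunE scalerA. Qed.
Fact dirsum_scale1 : left_id 1 dirsum_scale.
Proof. by move=> x; apply/ffunP => i; rewrite !ffunE scale1r. Qed.
Fact dirsum_scaleDr : right_distributive dirsum_scale +%R.
Proof. by move=> a x y; apply/ffunP => i; rewrite !ffunE scalerDr. Qed.
Fact dirsum_scaleDl x : {morph dirsum_scale^~ x : a b / a + b}.
Proof. by move=> a b; apply/ffunP => i; rewrite !ffunE scalerDl. Qed.
HB.instance Definition _ := GRing.Zmodule_isLmodule.Build R dirsum
  dirsum_scaleA dirsum_scale1 dirsum_scaleDr dirsum_scaleDl.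

End DirectSum.

Definition lmod_iso (R : pzRingType) (U V : lmodType R) : Prop :=
  exists f : {linear U -> V}, bijective f.

Definition has_order (V : zmodType) (x : V) (k : nat) : Prop :=
  [/\ (0 < k)%N, x *+ k = 0
    & forall m, (0 < m)%N -> x *+ m = 0 -> (k <= m)%N].

Section HalfIntegers.

Definition half_int_pred : {pred rat} :=
  fun q => `[< exists (z : int) (n : nat), q = z%:~R / 2 ^+ n >].

Fact half_int_closed : GRing.subring_closed half_int_pred.
Proof.
have e2 n : (2 ^+ n : rat) != 0 by rewrite expf_neq0.
split=> [|x y|x y]; rewrite !unfold_in.
- by apply/asboolP; exists 1, 0%N; rewrite expr0 divr1.
- move=> /asboolP[z [n ->]] /asboolP[w [m ->]].
  apply/asboolP; exists (z * 2 ^+ m - w * 2 ^+ n), (n + m)%N.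
  rewrite -mulNr addf_div // rmorphB !rmorphM !rmorphXn /= exprD.
  by rewrite mulNr.
- move=> /asboolP[z [n ->]] /asboolP[w [m ->]].
  by apply/asboolP; exists (z * w), (n + m)%N; rewrite mulf_div rmorphM exprD.
Qed.
HB.instance Definition _ :=
  GRing.isSubringClosed.Build rat half_int_pred half_int_closed.

Record half_int := HalfInt { half_int_val : rat; _ : half_int_val \in half_int_pred }.
HB.instance Definition _ := [isSub for half_int_val].
HB.instance Definition _ := [Choice of half_int by <:].
HB.instance Definition _ := [SubChoice_isSubComNzRing of half_int by <:].

End HalfIntegers.

(* A virtual link diagram is encoded as a plane map, in the style of a PD code.
   A dart is the germ of an edge at a vertex.  The four darts at a classical or
   virtual crossing are numbered counterclockwise.  At a classical crossing,
   dart 0 is the bottom left one in one of the two positions in which the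
   overstrand runs from bottom left to top right, so that 1, 2, 3 are bottom
   right, top right, top left, and the numbering records both the over/under
   information and the chosen position.  A vertex-free circle is given one
   auxiliary bivalent vertex, hence two darts. *)
Section Darts.
Variables N M K : nat.

Definition dart : finType := ('I_N * 'I_4 + 'I_M * 'I_4 + 'I_K * bool)%type.

Definition next4 (i : 'I_4) : 'I_4 := inord (nth 0%N [:: 1; 2; 3; 0]%N i).
Definition opp4 (i : 'I_4) : 'I_4 := inord (nth 0%N [:: 2; 3; 0; 1]%N i).

Definition rot (d : dart) : dart :=
  match d with
  | inl (inl (r, i)) => inl (inl (r, next4 i))
  | inl (inr (r, i)) => inl (inr (r, next4 i))
  | inr (k, b) => inr (k, ~~ b)
  end.

Definition straight (d : dart) : dart :=
  match d with
  | inl (inl (r, i)) => inl (inl (r, opp4 i))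
  | inl (inr (r, i)) => inl (inr (r, opp4 i))
  | inr (k, b) => inr (k, ~~ b)
  end.

End Darts.

Definition generated (T : finType) (f g : T -> T) : rel T :=
  connect [rel x y | (y == f x) || (y == g x)].

(* [glue] exchanges the two darts of each edge; [dir d] says that the
   orientation of the link points away from the vertex of [d] along [d].  The
   last axiom is planarity: faces are the orbits of [rot \o glue], and each
   connected component of the graph satisfies V - E + F = 2, where #|dart| is
   2 E and the number of orbits of [glue] is E. *)
Record vlink := VLink {
  nclassical : nat;
  nvirtual : nat;
  ncircles : nat;
  glue : dart nclassical nvirtual ncircles -> dart nclassical nvirtual ncircles;
  dir : dart nclassical nvirtual ncircles -> bool;
  _ : involutive glue;
  _ : forall d, glue d != d;
  _ : forall k b, glue (inr (k, b)) = inr (k, ~~ b);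
  _ : forall d, dir (glue d) = ~~ dir d;
  _ : forall d, dir (straight d) = ~~ dir d;
  _ : let rotation := @rot nclassical nvirtual ncircles in
      (fcard rotation predT + fcard glue predT + fcard (rotation \o glue) predT
      = #|dart nclassical nvirtual ncircles|
        + 2 * n_comp (generated rotation glue) predT)%N
}.

Section Cube.
Variable D : vlink.

Definition ldart := dart (nclassical D) (nvirtual D) (ncircles D).
Definition crossing := 'I_(nclassical D).
Definition cdart (r : crossing) (i : 'I_4) : ldart := inl (inl (r, i)).

Definition bot_left : 'I_4 := inord 0.
Definition bot_right : 'I_4 := inord 1.
Definition top_right : 'I_4 := inord 2.
Definition top_left : 'I_4 := inord 3.

Definition ncomponents : nat :=
  n_comp (generated (@glue D) (@straight _ _ _)) predT.

Definition negative (r : crossing) : bool :=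
  dir (cdart r top_right) != dir (cdart r top_left).
Definition nminus : nat := #|[set r | negative r]|.

Definition vertex := {ffun crossing -> bool}.
Definition weight (a : vertex) : nat := #|[set r | a r]|.
Definition flip (a : vertex) (r : crossing) : vertex :=
  [ffun s => (s == r) || a s].

(* 0-resolution: the strings join 0-3 and 1-2; 1-resolution: 0-1 and 2-3. *)
Definition resolve (a : vertex) (d : ldart) : ldart :=
  match d with
  | inl (inl (r, i)) =>
      cdart r (inord (nth 0%N (if a r then [:: 1; 0; 3; 2] else [:: 3; 2; 1; 0])%N i))
  | _ => straight d
  end.

(* A v-circle is represented by the set of darts it runs through. *)
Definition vcircle (a : vertex) (d : ldart) : {set ldart} :=
  [set e | generated (@glue D) (resolve a) d e].
Definition vcircles (a : vertex) : {set {set ldart}} :=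
  [set vcircle a d | d : ldart].

(* [numbering a] lists the v-circles of the resolution [a] in the order of
   their numbers.  [orient a d] says that the chosen orientation of the v-circle
   through [d] points away from the vertex of [d] along [d]. *)
Record choices := Choices {
  numbering : vertex -> seq {set ldart};
  orient : vertex -> ldart -> bool;
  _ : forall a, perm_eq (numbering a) (enum (vcircles a));
  _ : forall a d, orient a (glue d) = ~~ orient a d;
  _ : forall a d, orient a (resolve a d) = ~~ orient a d
}.

End Cube.

(* Matrix coefficients on the basis 1, X of A = R[X]/(X^2 = 1) and on its
   tensor powers; [false] stands for 1 and [true] for X. *)
Section Algebra.
Variable R : comPzRingType.

Definition m_coef (x y z : bool) : R :=
  match x, y, z with
  | false, false, false => 1
  | false, true, true => 1
  | true, false, true => 1
  | true, true, false => 1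
  | _, _, _ => 0
  end.

Definition Delta_coef (x y z : bool) : R :=
  match x, y, z with
  | false, false, true => 1
  | false, true, false => 1
  | true, false, false => 1
  | true, true, true => 1
  | _, _, _ => 0
  end.

Definition Phi_coef (x y : bool) : R :=
  match x, y with
  | false, false => 1
  | true, true => -1
  | _, _ => 0
  end.

Definition theta_coef (x y : bool) : R := 0.

Definition Phi_if (b : bool) (x y : bool) : R :=
  if b then Phi_coef x y else (x == y)%:R.

End Algebra.

(* The permutation p with s_i = t_(p i), for duplicate-free s and t with the
   same elements. *)
Definition comparison (T : finType) (s t : seq {set T}) : {perm 'I_(size s)} :=
  odflt (perm_one _) [pick p : {perm 'I_(size s)} |
    [forall i : 'I_(size s), nth set0 s i == nth set0 t (p i)]].

Section LeeComplex.
Variables (D : vlink) (ch : choices D) (R : comPzRingType).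
Implicit Types (a b : vertex D) (r : crossing D) (C E : {set ldart D}).

(* The words in 1, X forming the basis of the tensor power of A at [a]. *)
Definition word a := (size (numbering ch a)).-tuple bool.

Definition letter a (v : word a) C : bool := nth false v (index C (numbering ch a)).

Definition sgn (s t : seq {set ldart D}) : R := (-1) ^+ odd_perm (comparison s t).

Definition involved r C : bool := [exists i, cdart r i \in C].
Definition uninvolved a r : seq {set ldart D} :=
  enum [set C in vcircles a | ~~ involved r C].

(* v-circle carrying the x-marker (left string of the 0-resolution, bottom
   string of the 1-resolution) and v-circle through the other string. *)
Definition xcircle a r := vcircle a (cdart r (bot_left)).
Definition ycircle a r := vcircle a (cdart r (top_right)).

(* Standard orientation: left string down and right string up in the
   0-resolution.  In the 1-resolution it is the orientation with the same
   behaviour at the four end points: these are the end points of the saddle, and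
   only this convention makes the faces of the cube anticommute. *)
Definition std_out (i : 'I_4) : bool := (i == bot_left) || (i == top_right).
Definition nonstd a r C : bool :=
  [exists i, (cdart r i \in C) && (orient ch a (cdart r i) != std_out i)].

Definition disagree a b C : bool :=
  [exists d in C, orient ch a d != orient ch b d].

(* Coefficient, at the basis elements v and w, of the component of the
   differential along the saddle at r from a to b (b is a with r switched from 0
   to 1). *)
Definition saddle_coef r a b (v : word a) (w : word b) : R :=
  let Es := uninvolved a r in
  let Cx := xcircle a r in let Cy := ycircle a r in
  let Cx' := xcircle b r in let Cy' := ycircle b r in
  let rest := \prod_(E <- Es) Phi_if R (disagree a b E) (letter v E) (letter w E) in
  if Cx != Cy then
    sgn (numbering ch a) [:: Cx, Cy & Es] * sgn (numbering ch b) (Cx' :: Es) *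
    (\sum_x \sum_y \sum_z
       Phi_if R (nonstd a r Cx) (letter v Cx) x *
       Phi_if R (nonstd a r Cy) (letter v Cy) y *
       m_coef R x y z *
       Phi_if R (nonstd b r Cx') z (letter w Cx')) * rest
  else if Cx' != Cy' then
    sgn (numbering ch a) (Cx :: Es) * sgn (numbering ch b) [:: Cx', Cy' & Es] *
    (\sum_x \sum_y \sum_z
       Phi_if R (nonstd a r Cx) (letter v Cx) x *
       Delta_coef R x y z *
       Phi_if R (nonstd b r Cx') y (letter w Cx') *
       Phi_if R (nonstd b r Cy') z (letter w Cy')) * rest
  else
    theta_coef R (letter v Cx) (letter w Cx') * rest.

Definition generator := {a : vertex D & word a}.
Definition degree (g : generator) : int := (weight (tag g))%:Z - (nminus D)%:Z.
Definition generator_in (k : int) := {g : generator | degree g == k}.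

Definition d_coef (g h : generator) : R :=
  \sum_(r | ~~ tag g r && (tag h == flip (tag g) r))
    saddle_coef r (tagged g) (tagged h).

Definition chain (k : int) := {ffun generator_in k -> R^o}.

Definition differential (k l : int) (c : chain k) : chain l :=
  [ffun h => \sum_g c g * d_coef (val g) (val h)].

Fact differential_linear k l : linear (@differential k l).
Proof.
move=> a x y; apply/ffunP => h; rewrite !ffunE scaler_sumr -big_split.
by apply: eq_bigr => g _; rewrite !ffunE mulrDl; congr (_ + _); rewrite -mulrA.
Qed.
HB.instance Definition _ k l :=
  GRing.isLinear.Build R (chain k) (chain l) *:%R (@differential k l)
    (@differential_linear k l).

Definition Lee_homology (k : int) : lmodType R :=
  homology (@differential (k - 1) k) (@differential k (k + 1)).

(* All the other chain modules are zero. *)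
Definition total_Lee_homology : lmodType R :=
  dirsum (fun i : 'I_(nclassical D).+1 => Lee_homology (i%:Z - (nminus D)%:Z)).

End LeeComplex.

(* Main.v *)
(* In the tensor factors use the colours 1 + X and 1 - X: they multiply to twice
   themselves or to 0, comultiply to their squares up to sign, and are exchanged by
   Phi.  Since Phi reverses a v-circle, a colouring of the v-circles of a resolution
   a is the same as an orientation o of all strings coherent with a, and the
   differential preserves o: it sends (a, o) to multiples of (a + r, o), where r
   runs over the 0-resolved crossings at which o alternates (out, in, out, in).  Up
   to powers of 2 the complex thus splits into one sector for each o, a cube of rank
   one modules over the crossings at which o alternates.

   The faces anticommute: following o along the strings turns a resolution into a
   permutation, switching a crossing multiplies it by a transposition, and the sign
   of an edge does not depend on its direction.  So one may start from a corner
   where both saddles of the face are merges.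

   If o alternates somewhere, inverting the edges of one direction up to 2
   contracts twice the identity of the sector.  If o alternates nowhere, it is an
   orientation of the link, of which there are 2 ^ n, and its sector is a single
   copy of R.  Hence the coordinates on the latter sectors map the homology to
   R ^ (2 ^ n) with kernel and cokernel killed by a power of 2. *)

Require Import Defs.
From HB Require Import structures.
From mathcomp Require Import all_boot all_order all_algebra.
From mathcomp Require Import perm generic_quotient ring_quotient boolp zify ring.

Set Implicit Arguments.
Unset Strict Implicit.
Unset Printing Implicit Defensive.

Import GRing.Theory Num.Theory.

(** * Signs of reorderings *)

Section SignOfComparison.
Variable T : finType.
Implicit Types (s t u : seq {set T}) (x y : {set T}).

(** The colours 1 + X and 1 - X are a basis only after inverting 2. Coordinates are therefore taken
    as pairings with the colours, identities are multiplied up to the common power [2 ^+ depth], and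
    powers of 2 are cancelled where 2 is regular. A merge has coefficient 2 up to sign and a split a
    unit, so the complementary coefficients stay integral and contract twice the identity.

    The delicate point is the sign. Delta sends 1 - X to minus its square, and the string carrying
    the x-marker depends on the resolution. These two effects compensate if the v-circles at a
    crossing are ordered by the two darts along which [o] leaves it: the resulting sign is blind to
    the direction of the edge. A non-orientable saddle fits in with coefficient 0, because no
    coherent [o] alternates there.

    Over the integers, kernel and cokernel killed by powers of 2 still have to yield a direct sum.
    The image is a subgroup of finite index in a free group, and a basis of it is found by
    minimising a determinant. *)

Definition cmp_odd s t : bool := odd_perm (comparison s t).

(** The length is a free [n], so that permutations attached to lists whose sizes are only provably
    equal can be compared and composed. *)
Lemma cmp_oddE n (p : 'S_n) s t : size s = n -> size t = n -> uniq t ->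
  (forall i : 'I_n, nth set0 s i = nth set0 t (p i)) -> cmp_odd s t = odd_perm p.
Proof.
move=> sz_s; move: p; rewrite -{}sz_s => p sz_t uniq_t nth_p.
rewrite /cmp_odd /comparison; case: pickP => [q /forallP nth_q | /(_ p)] /=.
  congr odd_perm; apply/permP => i; apply/val_inj/eqP.
  rewrite -(nth_uniq set0 _ _ uniq_t) ?sz_t ?ltn_ord //.
  by rewrite -(eqP (nth_q i)) nth_p.
by move/negP; case; apply/forallP => i; rewrite nth_p.
Qed.

Lemma comparison_exists s t : perm_eq s t -> uniq t ->
  exists p : 'S_(size t), forall i : 'I_(size t),
    nth set0 s i = nth set0 t (p i).
Proof.
move=> st uniq_t; have sz := perm_size st.
have ltx (i : 'I_(size t)) : (index (nth set0 s i) t < size t)%N.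
  by rewrite index_mem -(perm_mem st) mem_nth // sz.
pose f i := Ordinal (ltx i).
have f_inj : injective f.
  move=> i j /(congr1 val) /= eq_ij; apply/val_inj/eqP.
  rewrite -(nth_uniq set0 _ _ (_ : uniq s)) ?sz ?ltn_ord ?(perm_uniq st) //.
  have mem k : nth set0 s (k : 'I_(size t)) \in t.
    by rewrite -(perm_mem st) mem_nth // sz.
  by rewrite -(nth_index set0 (mem i)) eq_ij nth_index.
exists (perm f_inj) => i; rewrite permE /= nth_index //.
by rewrite -(perm_mem st) mem_nth // sz.
Qed.

Lemma cmp_odd_trans t s u : perm_eq s t -> perm_eq t u -> uniq u ->
  cmp_odd s t (+) cmp_odd t u = cmp_odd s u.
Proof.
move=> st tu uniq_u; have sz_t := perm_size tu; have sz_s := perm_size st.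
have uniq_t : uniq t by rewrite (perm_uniq tu).
have [p Hp] := comparison_exists st uniq_t.
have [q Hq] := comparison_exists tu uniq_u.
move: p Hp; rewrite sz_t => p Hp.
rewrite (cmp_oddE _ _ _ Hp) ?(cmp_oddE _ _ _ Hq) ?sz_s //.
rewrite (@cmp_oddE _ (p * q)%g) ?sz_s ?odd_permM // => i.
by rewrite Hp Hq permM.
Qed.

Lemma cmp_odd_refl s : uniq s -> cmp_odd s s = false.
Proof.
by move=> s_uniq; rewrite (@cmp_oddE (size s) 1%g) ?odd_perm1 // => i; rewrite perm1.
Qed.

Lemma cmp_odd_sym s t : perm_eq s t -> uniq t -> cmp_odd s t = cmp_odd t s.
Proof.
move=> st uniq_t; have uniq_s : uniq s by rewrite (perm_uniq st).
have ts : perm_eq t s by rewrite perm_sym.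
by have := cmp_odd_trans st ts uniq_s; rewrite cmp_odd_refl //; do 2!case: cmp_odd.
Qed.

Lemma cmp_odd_cons x s t : perm_eq s t -> uniq (x :: t) ->
  cmp_odd (x :: s) (x :: t) = cmp_odd s t.
Proof.
move=> st uniq_xt; have uniq_t: uniq t by case/andP: uniq_xt.
have [p Hp] := comparison_exists st uniq_t; have sz := perm_size st.
rewrite (cmp_oddE _ _ _ Hp) // (@cmp_oddE _ (lift_perm ord0 ord0 p)) /= ?sz //.
  by rewrite odd_lift_perm.
move=> i; case: (unliftP ord0 i) => [j|] ->; first by rewrite lift_perm_lift /= Hp.
by rewrite lift_perm_id.
Qed.

Lemma cmp_odd_swap x y s t : perm_eq s t -> uniq (x :: y :: t) ->
  cmp_odd (x :: y :: s) (y :: x :: t) = ~~ cmp_odd s t.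
Proof.
move=> st uniq_xyt.
have perm_swap : perm_eq (x :: y :: t) (y :: x :: t).
  by apply/seq.permP => a /=; rewrite addnCA.
rewrite -(@cmp_odd_trans (x :: y :: t)) ?perm_cons -?(perm_uniq perm_swap) //.
rewrite !cmp_odd_cons ?perm_cons //; last by case/andP: uniq_xyt.
pose i1 : 'I_(size t).+2 := lift ord0 ord0.
rewrite (@cmp_oddE _ (tperm ord0 i1) (x :: y :: t)) -?(perm_uniq perm_swap) //.
  by rewrite odd_tperm addbT.
move=> i; case: tpermP => [-> | -> |] //.
by case: i => [[|[|i]] lti] // ne0 ne1; [case: ne0 | case: ne1]; apply/val_inj.
Qed.


Lemma cmp_odd_cycle x y z s : uniq [:: x, y, z & s] ->
  cmp_odd [:: x, y, z & s] [:: y, z, x & s] = false.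
Proof.
move=> uniq_xyz.
have p1 : perm_eq [:: x, y, z & s] [:: y, x, z & s].
  by apply/seq.permP => a /=; rewrite addnCA.
have p2 : perm_eq [:: y, x, z & s] [:: y, z, x & s].
  by rewrite perm_cons; apply/seq.permP => a /=; rewrite addnCA.
have u1 : uniq [:: y, x, z & s] by rewrite -(perm_uniq p1).
have u2 : uniq [:: y, z, x & s] by rewrite -(perm_uniq p2).
rewrite -(cmp_odd_trans p1 p2) // cmp_odd_swap // (@cmp_odd_cons y) //; last first.
  by apply/seq.permP => a /=; rewrite addnCA.
rewrite cmp_odd_swap //; last by case/andP: u1.
have uniq_zs : uniq (z :: s) by case/and3P: uniq_xyz.
by rewrite !cmp_odd_refl //; case/andP: uniq_zs.
Qed.

Lemma cmp_odd_cycleV x y z s : uniq [:: x, y, z & s] ->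
  cmp_odd [:: x, y, z & s] [:: z, x, y & s] = false.
Proof.
move=> uniq_xyz; have p : perm_eq [:: x, y, z & s] [:: z, x, y & s].
  by apply/seq.permP => a /=; rewrite (addnCA (a z)) (addnCA (a y)).
have uniq_zxy : uniq [:: z, x, y & s] by rewrite -(perm_uniq p).
by rewrite cmp_odd_sym // cmp_odd_cycle.
Qed.

(** Sign exponent of a saddle merging [x] and [y] of the numbering [s] into [z] of [t]. A split is
    the same expression read from [t] to [s]. *)
Definition merge_odd s t x y z u : bool :=
  cmp_odd s [:: x, y & u] (+) cmp_odd t (z :: u).

Lemma merge_odd_perm s t x y z u u' :
  perm_eq s [:: x, y & u] -> uniq s -> perm_eq t (z :: u) -> uniq t ->
  perm_eq u u' -> merge_odd s t x y z u = merge_odd s t x y z u'.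
Proof.
move=> s_xyu uniq_s t_zu uniq_t uu'.
have s_xyu' : perm_eq s [:: x, y & u'] by rewrite (perm_trans s_xyu) // !perm_cons.
have t_zu' : perm_eq t (z :: u') by rewrite (perm_trans t_zu) // perm_cons.
have := uniq_s; have := uniq_t.
rewrite (perm_uniq s_xyu') (perm_uniq t_zu') => uniq_z uniq_xy.
rewrite /merge_odd -(cmp_odd_trans s_xyu (_ : perm_eq _ [:: x, y & u'])) ?perm_cons //.
rewrite -(cmp_odd_trans t_zu (_ : perm_eq _ (z :: u'))) ?perm_cons //.
rewrite !cmp_odd_cons ?perm_cons //; last by case/andP: uniq_xy.
by rewrite addbACA addbb addbF.
Qed.

Lemma merge_oddC s t x y z u : perm_eq s [:: x, y & u] -> uniq s ->
  merge_odd s t y x z u = ~~ merge_odd s t x y z u.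
Proof.
move=> s_xyu uniq_s; have uniq_xyu := uniq_s; rewrite (perm_uniq s_xyu) in uniq_xyu.
have xy_yx : perm_eq [:: x, y & u] [:: y, x & u].
  by apply/seq.permP => a /=; rewrite addnCA.
rewrite /merge_odd -(cmp_odd_trans s_xyu xy_yx) -?(perm_uniq xy_yx) //.
rewrite cmp_odd_swap // cmp_odd_refl ?addbT ?addNb //.
by case/and3P: uniq_xyu.
Qed.

(* Faces of the cube are listed as (base, first flip, second flip, both). *)
Lemma face_disjoint l0 l1 l2 l12 A B C D AB CD u :
  perm_eq l0 [:: A, B, C, D & u] -> uniq l0 ->
  perm_eq l1 [:: AB, C, D & u] -> uniq l1 ->
  perm_eq l2 [:: CD, A, B & u] -> uniq l2 ->
  perm_eq l12 [:: AB, CD & u] -> uniq l12 ->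
  (merge_odd l0 l1 A B AB [:: C, D & u] (+) merge_odd l1 l12 C D CD (AB :: u))
  (+) (merge_odd l0 l2 C D CD [:: A, B & u] (+) merge_odd l2 l12 A B AB (CD :: u)).
Proof.
move=> e0 u0 e1 u1 e2 u2 e12 u12; rewrite /merge_odd.
have q0 : perm_eq [:: A, B, C, D & u] [:: C, A, B, D & u].
  by apply/seq.permP => a /=; rewrite (addnCA _ (a C)) (addnCA (a A)).
have q0' : perm_eq [:: C, A, B, D & u] [:: C, D, A, B & u].
  by apply/seq.permP => a /=; rewrite (addnCA (a B) (a D)) (addnCA (a A)).
have q1 : perm_eq [:: AB, C, D & u] [:: C, D, AB & u].
  by apply/seq.permP => a /=; rewrite addnCA (addnCA (a AB)).
have q2 : perm_eq [:: CD, A, B & u] [:: A, B, CD & u].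
  by apply/seq.permP => a /=; rewrite addnCA (addnCA (a CD)).
have q12 : perm_eq [:: AB, CD & u] [:: CD, AB & u].
  by apply/seq.permP => a /=; rewrite addnCA.
have v0 := u0; rewrite (perm_uniq e0) in v0.
have v0' := v0; rewrite (perm_uniq q0) in v0'.
have v0'' := v0'; rewrite (perm_uniq q0') in v0''.
have v1 := u1; rewrite (perm_uniq e1) in v1.
have v1' := v1; rewrite (perm_uniq q1) in v1'.
have v2 := u2; rewrite (perm_uniq e2) in v2.
have v2' := v2; rewrite (perm_uniq q2) in v2'.
have v12 := u12; rewrite (perm_uniq e12) in v12.
have v12' := v12; rewrite (perm_uniq q12) in v12'.
have -> : cmp_odd l0 [:: C, D, A, B & u] = cmp_odd l0 [:: A, B, C, D & u].
  rewrite -(cmp_odd_trans e0 (perm_trans q0 q0')) // -(cmp_odd_trans q0 q0') //.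
  have [uABD q] : uniq [:: A, B, D & u] /\ perm_eq [:: A, B, D & u] [:: D, A, B & u].
    by split; [case/andP: v0' | rewrite -(perm_cons C)].
  by rewrite (cmp_odd_cycleV v0) (cmp_odd_cons q v0'') (cmp_odd_cycleV uABD) !addbF.
rewrite -(cmp_odd_trans e1 q1) // cmp_odd_cycle //.
rewrite -(cmp_odd_trans e2 q2) // cmp_odd_cycle //.
(* The other reorderings are products of 3-cycles, hence even; exchanging the two merged v-circles
   is the only odd one. *)
rewrite -(cmp_odd_trans e12 q12) // cmp_odd_swap // cmp_odd_refl; last by case/and3P: v12.
by do 4!case: cmp_odd.
Qed.

(** Moving A behind B and C is even, whereas exchanging BC with A is odd. *)
Lemma face_chain l0 l1 l2 l12 A B C AB BC ABC u :
  perm_eq l0 [:: A, B, C & u] -> uniq l0 ->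
  perm_eq l1 [:: AB, C & u] -> uniq l1 ->
  perm_eq l2 [:: BC, A & u] -> uniq l2 ->
  perm_eq l12 (ABC :: u) -> uniq l12 ->
  (merge_odd l0 l1 A B AB (C :: u) (+) merge_odd l1 l12 AB C ABC u)
  (+) (merge_odd l0 l2 B C BC (A :: u) (+) merge_odd l2 l12 A BC ABC u).
Proof.
move=> e0 u0 e1 u1 e2 u2 e12 u12; rewrite /merge_odd.
have q0 : perm_eq [:: A, B, C & u] [:: B, C, A & u].
  by apply/seq.permP => a /=; rewrite addnCA (addnCA (a A)).
have q2 : perm_eq [:: BC, A & u] [:: A, BC & u].
  by apply/seq.permP => a /=; rewrite addnCA.
have v0 := u0; rewrite (perm_uniq e0) in v0.
have v0' := v0; rewrite (perm_uniq q0) in v0'.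
have v2 := u2; rewrite (perm_uniq e2) in v2.
have v2' := v2; rewrite (perm_uniq q2) in v2'.
rewrite -(cmp_odd_trans e0 q0) // cmp_odd_cycle //.
rewrite -(cmp_odd_trans e2 q2) // cmp_odd_swap // cmp_odd_refl; last by case/and3P: v2.
by do 4!case: cmp_odd.
Qed.

End SignOfComparison.

(** * Cycles of permutations and transpositions *)

Section CyclesAndTranspositions.
Variable T : finType.
Implicit Types (s : {perm T}) (x y z : T).

Lemma porbit_sub s (A : {set T}) x :
  {in A, forall y, s y \in A} -> x \in A -> porbit s x \subset A.
Proof.
move=> sA xA; apply/subsetP => y /porbitP[i ->].
by elim: i => [|i IH]; rewrite ?expg0 ?perm1 // expgSr permM sA.
Qed.

Lemma porbit_tperm_out s x y z : z \notin porbit s x -> z \notin porbit s y ->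
  porbit (tperm x y * s) z = porbit s z.
Proof.
move=> zx zy; have E i : ((tperm x y * s) ^+ i)%g z = (s ^+ i)%g z.
  elim: i => [|i IH]; first by rewrite !expg0.
  rewrite !expgSr !permM IH; congr (s _).
  have := mem_porbit s i z; rewrite porbit_sym; set w := (s ^+ i)%g z => zw.
  by apply: tpermD; apply/eqP => e; [case/negP: zx | case/negP: zy]; rewrite e.
by apply/setP => w; apply/porbitP/porbitP => -[i ->]; exists i; rewrite E.
Qed.

(** The formula for the change of the number of cycles, applied to [s] and to its product with the
    transposition, excludes that [x] and [y] share a cycle in both or in neither. *)
Lemma mem_porbit_tperm s x y : x != y ->
  (x \in porbit (tperm x y * s) y) = (x \notin porbit s y).
Proof.
move=> xy; have := porbits_mul_tperm s x y.
have /= := porbits_mul_tperm (tperm x y * s) x y.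
rewrite mulgA tperm2 mul1g xy.
by do 2!case: (_ \in _) => /=; lia.
Qed.

Lemma mem_porbit_step s x y : (s y \in porbit s x) = (y \in porbit s x).
Proof.
have := porbit_perm s 1 y; rewrite expg1 => e.
by rewrite porbit_sym e porbit_sym.
Qed.

Lemma porbit_tperm_sub s x y z : z \in porbit s x :|: porbit s y ->
  porbit (tperm x y * s) z \subset porbit s x :|: porbit s y.
Proof.
apply: porbit_sub => w; rewrite permM !inE !mem_porbit_step.
by case: tpermP => [->|->|_ _] //; rewrite !porbit_id ?orbT.
Qed.

Ltac tperm_simp a b c d :=
  repeat first [rewrite tpermL | rewrite tpermR
    | rewrite [tperm _ _ a]tpermD; [| by [] | by []]
    | rewrite [tperm _ _ b]tpermD; [| by [] | by []]
    | rewrite [tperm _ _ c]tpermD; [| by [] | by []]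
    | rewrite [tperm _ _ d]tpermD; [| by [] | by []]].

(* The two transpositions compose to (x y') (x' y) after (x x') (y y') has cut
   both cycles, so the new cycle of x meets only the old halves of x and y'. *)
Lemma porbit_tperm_cross s x y x' y' : uniq [:: x; y; x'; y'] ->
  y \notin porbit s x -> x' \in porbit s x -> y' \in porbit s y ->
  x' \notin porbit (tperm x y * (tperm x' y' * s)) x.
Proof.
move=> /and4P[]; rewrite !inE !negb_or => /and3P[xy xx' xy'] /andP[yx' yy'] x'y' _.
move=> ysx x's y's; pose s1 := (tperm x x' * s)%g; pose s2 := (tperm y y' * s1)%g.
have -> : (tperm x y * (tperm x' y' * s) = tperm x y' * (tperm x' y * s2))%g.
  apply/permP => z; rewrite !permM; congr (s _).
  have [yx x'x y'x] : [/\ y != x, x' != x & y' != x] by split; rewrite eq_sym.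
  have [x'y y'y y'x'] : [/\ x' != y, y' != y & y' != x'].
    by split; rewrite eq_sym.
  case: (eqVneq z x) => [->|zx]; first by tperm_simp x y x' y'.
  case: (eqVneq z y) => [->|zy]; first by tperm_simp x y x' y'.
  case: (eqVneq z x') => [->|zx']; first by tperm_simp x y x' y'.
  case: (eqVneq z y') => [->|zy']; first by tperm_simp x y x' y'.
  by rewrite !(tpermD (z := z)) // 1?eq_sym.
have xs_y : x \notin porbit s y by rewrite porbit_sym.
have eqx : porbit s x' = porbit s x by apply/eqP; rewrite eq_porbit_mem.
have eqy : porbit s y' = porbit s y by apply/eqP; rewrite eq_porbit_mem.
have x's1 : x' \notin porbit s1 x.
  by rewrite porbit_sym mem_porbit_tperm // negbK eqx porbit_id.
have eqy1 : porbit s1 y = porbit s y.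
  by apply: porbit_tperm_out; rewrite ?eqx.
have eqy1' : porbit s1 y' = porbit s1 y.
  by apply/eqP; rewrite eq_porbit_mem eqy1.
have y's2 : y \notin porbit s2 y'.
  by rewrite mem_porbit_tperm // negbK eqy1' porbit_id.
have s2_out z : z \notin porbit s y -> porbit s2 z = porbit s1 z.
  by move=> zy; apply: porbit_tperm_out; rewrite ?eqy1' eqy1.
have x's_y : x' \notin porbit s y by rewrite porbit_sym eqx.
have eqs3 z : z \in [:: x; y'] -> porbit (tperm x' y * s2) z = porbit s2 z.
  rewrite !inE => /orP[] /eqP->; apply: porbit_tperm_out; rewrite porbit_sym.
  - by rewrite s2_out.
  - by rewrite s2_out // porbit_sym eqy1.
  - by rewrite porbit_sym s2_out // porbit_sym eqy1' eqy1.
  - by [].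
have := @porbit_tperm_sub (tperm x' y * s2) x y' x.
rewrite !eqs3 ?inE ?eqxx ?orbT // porbit_id => /(_ isT)/subsetP sub.
apply/negP => /sub; rewrite !inE s2_out // (negPf x's1) /=.
by rewrite porbit_sym s2_out // porbit_sym eqy1' eqy1 (negPf x's_y).
Qed.

End CyclesAndTranspositions.

(** * v-circles of a state *)

Section Generated.
Variables (T : finType) (f g : T -> T).
Hypotheses (fK : involutive f) (gK : involutive g).

Lemma generated_connect_sym : connect_sym [rel x y | (y == f x) || (y == g x)].
Proof.
apply: sym_connect_sym => x y /=.
by rewrite -(inv_eq fK) -(inv_eq gK) [f y == x]eq_sym [g y == x]eq_sym.
Qed.

Lemma generated_sym : symmetric (generated f g).
Proof. exact: generated_connect_sym. Qed.

Lemma generated_trans : transitive (generated f g).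
Proof. exact: connect_trans. Qed.

Lemma generated_refl : reflexive (generated f g).
Proof. exact: connect0. Qed.

Lemma generated_f x : generated f g x (f x).
Proof. by apply: connect1; rewrite /= eqxx. Qed.

Lemma generated_g x : generated f g x (g x).
Proof. by apply: connect1; rewrite /= eqxx orbT. Qed.

Lemma generated_ind (P : T -> Prop) x :
  P x -> (forall y, P y -> P (f y)) -> (forall y, P y -> P (g y)) ->
  forall y, generated f g x y -> P y.
Proof.
move=> Px Pf Pg y /connectP[p]; elim: p x Px => [|z p IH] x Px /=; first by move=> _ ->.
by case/andP=> /orP[]/eqP-> pth; apply: IH pth; [apply: Pf | apply: Pg].
Qed.

End Generated.

Section Diagram.
Variable D : vlink.
Implicit Types (a b : vertex D) (r s : crossing D) (d e : ldart D) (C : {set ldart D}).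
Implicit Types o : {ffun ldart D -> bool}.

Lemma glueK : involutive (@glue D). Proof. by case: D. Qed.
Lemma dir_glue d : dir (glue d) = ~~ dir d. Proof. by case: D d. Qed.
Lemma dir_straight d : @dir D (straight d) = ~~ dir d. Proof. by case: D d. Qed.

Lemma ord4P (i : 'I_4) :
  [\/ i = bot_left, i = bot_right, i = top_right | i = top_left].
Proof.
case: i => [[|[|[|[|i]]]] lti] //; [constructor 1|constructor 2|constructor
  3|constructor 4];
  by apply/val_inj; rewrite /= inordK.
Qed.

Lemma opp4E : (opp4 bot_left = top_right) * (opp4 bot_right = top_left)
  * (opp4 top_right = bot_left) * (opp4 top_left = bot_right).
Proof. by do !split; rewrite /opp4 inordK. Qed.

Lemma resolve_cdart a r :
  (resolve a (cdart r bot_left) = cdart r (if a r then bot_right else top_left))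
  * (resolve a (cdart r bot_right) = cdart r (if a r then bot_left else top_right))
  * (resolve a (cdart r top_right) = cdart r (if a r then top_left else bot_right))
  * (resolve a (cdart r top_left) = cdart r (if a r then top_right else bot_left)).
Proof. by do !split; rewrite /= inordK //; case: (a r). Qed.

Lemma ord4_neq : (bot_left == bot_right = false) * (bot_left == top_right = false)
 * (bot_left == top_left = false) * (bot_right == bot_left = false)
 * (bot_right == top_right = false) * (bot_right == top_left = false)
 * (top_right == bot_left = false) * (top_right == bot_right = false)
 * (top_right == top_left = false) * (top_left == bot_left = false)
 * (top_left == bot_right = false) * (top_left == top_right = false).
Proof. by do !split; apply/eqP => /(congr1 (@nat_of_ord 4)); rewrite !inordK. Qed.

Lemma cdart_eq r s i j : (@cdart D r i == cdart s j) = (r == s) && (i == j).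
Proof. by []. Qed.

Lemma straightK : involutive (@straight (nclassical D) (nvirtual D) (ncircles D)).
Proof.
case=> [[] [r i]|[k b]] /=; last by rewrite negbK.
  by case: (ord4P i) => ->; rewrite !opp4E.
by case: (ord4P i) => ->; rewrite !opp4E.
Qed.

Lemma resolveK a : involutive (@resolve D a).
Proof.
case=> [[[r i]|x]|x].
- rewrite -/(cdart r i).
  by case: (ord4P i) => ->; rewrite !resolve_cdart; case: (a r) (resolve_cdart a r) => E;
    rewrite !E.
- by case: x => v i; exact: (straightK (inl (inr (v, i)))).
by case: x => k b; exact: (straightK (inr (k, b))).
Qed.

Lemma mem_vcircle a d : d \in vcircle a d.
Proof. by rewrite inE generated_refl. Qed.

Lemma vcircle_eq a d e : (vcircle a e == vcircle a d) = (e \in vcircle a d).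
Proof.
apply/eqP/idP => [<-|]; first exact: mem_vcircle.
rewrite inE => de; apply/setP => x; rewrite !inE.
have sym := generated_sym glueK (resolveK a).
by apply/idP/idP; apply: generated_trans => //; rewrite sym.
Qed.

Lemma vcircle_glue a d : vcircle a (glue d) = vcircle a d.
Proof. by apply/eqP; rewrite vcircle_eq inE generated_f. Qed.

Lemma vcircle_resolve a d : vcircle a (resolve a d) = vcircle a d.
Proof. by apply/eqP; rewrite vcircle_eq inE generated_g. Qed.

Lemma vcircle_sub a d C : d \in C -> (forall e, e \in C -> glue e \in C) ->
  (forall e, e \in C -> resolve a e \in C) -> vcircle a d \subset C.
Proof. by move=> dC Cg Cr; apply/subsetP => e; rewrite inE;
  exact: (@generated_ind _ _ _ (fun e => e \in C)). Qed.

Lemma vcirclesP a C : reflect (exists d, C = vcircle a d) (C \in vcircles a).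
Proof. by apply: (iffP imsetP) => [[d _ ->]|[d ->]]; exists d. Qed.

Lemma vcircle_in a d : vcircle a d \in vcircles a.
Proof. by apply/vcirclesP; exists d. Qed.

Lemma vcircle_id a C d : C \in vcircles a -> d \in C -> vcircle a d = C.
Proof. by case/vcirclesP => e ->; rewrite -vcircle_eq => /eqP. Qed.

(** Unlike [flip] this is an involution, so that facts about an edge or a face can be transported
    between its corners. *)
Definition toggle a r : vertex D := [ffun s => (s == r) (+) a s].

Lemma toggleK r : involutive (toggle^~ r).
Proof. by move=> a; apply/ffunP => s; rewrite !ffunE addbA addbb. Qed.

Lemma toggleC a r s : toggle (toggle a r) s = toggle (toggle a s) r.
Proof. by apply/ffunP => t; rewrite !ffunE addbCA. Qed.

Lemma toggle_flip a r : ~~ a r -> flip a r = toggle a r.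
Proof.
move=> ar; apply/ffunP => s; rewrite !ffunE.
by case: eqP => [->|//]; rewrite (negPf ar).
Qed.

Definition coherent a o : bool :=
  [forall d, (o (glue d) == ~~ o d) && (o (resolve a d) == ~~ o d)].

Lemma coherentP a o :
  reflect (forall d, o (glue d) = ~~ o d /\ o (resolve a d) = ~~ o d) (coherent a o).
Proof.
by apply: (iffP forallP) => H d; [case/andP: (H d) => /eqP-> /eqP-> | case: (H d) => ->
  ->; rewrite !eqxx].
Qed.

Lemma coherent_glue a o d : coherent a o -> o (glue d) = ~~ o d.
Proof. by case/coherentP/(_ d). Qed.

Lemma coherent_resolve a o d : coherent a o -> o (resolve a d) = ~~ o d.
Proof. by case/coherentP/(_ d). Qed.

Definition alternating o r : bool :=
  [&& o (cdart r bot_left) == o (cdart r top_right),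
      o (cdart r bot_right) == o (cdart r top_left)
    & o (cdart r bot_left) != o (cdart r bot_right)].

Lemma resolve_toggle_other a r d : (forall i, d != cdart r i) ->
  resolve (toggle a r) d = resolve a d.
Proof.
case: d => [[[s i]|//]|//] /(_ i) /=; rewrite -/(cdart s i) cdart_eq eqxx andbT =>
  /negPf sr.
by rewrite ffunE sr.
Qed.

Lemma coherent_toggle a o r : coherent a o -> alternating o r -> coherent (toggle a r) o.
Proof.
move=> co /and3P[/eqP o1 /eqP o2 o3]; apply/coherentP => d;
  rewrite (coherent_glue _ co); split=> //.
case: (boolP [forall i, d != cdart r i]) => [/forallP other|].
  by rewrite resolve_toggle_other // (coherent_resolve _ co).
rewrite negb_forall => /existsP[i /negPn/eqP->].
case: (ord4P i) => ->; rewrite resolve_cdart; case: (toggle a r r);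
  by move: o1 o2 o3; do 4!case: (o _).
Qed.

(* The dart of [r] through which the overall orientation [o] leaves along the
   string carrying the x-marker of the 0-resolution, or along the other one. *)
Definition exit_dart o r (x : bool) : ldart D :=
  cdart r (if o (cdart r bot_left) then (if x then bot_left else top_right)
           else (if x then top_left else bot_right)).

Lemma exit_dart_out o r x : alternating o r -> o (exit_dart o r x).
Proof.
rewrite /exit_dart => /and3P[/eqP o1 /eqP o2 o3].
by move: o1 o2 o3; case: x; case E: (o (cdart r bot_left));
   rewrite ?E; case: (o (cdart r bot_right)) => //=; do ?case: (o _).
Qed.

Lemma exit_dart_eq o r s x y :
  (exit_dart o r x == exit_dart o s y) = (r == s) && (x == y).
Proof.
rewrite cdart_eq; case: eqP => //= ->.
by case: (o _); case: x y => [] []; rewrite ?eqxx ?ord4_neq.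
Qed.

(** One step against [o], from an outgoing dart to the outgoing dart before it. The resolution acts
    first, so that switching a crossing is precomposition with a transposition. Incoming darts are
    fixed to obtain a permutation of all darts. *)
Definition walk a o d : ldart D := if o d then glue (resolve a d) else d.

Lemma walk_inj a o : coherent a o -> injective (walk a o).
Proof.
move=> co d e; rewrite /walk.
have out x : o x -> o (glue (resolve a x)).
  by rewrite (coherent_glue _ co) (coherent_resolve _ co) negbK.
case od: (o d); case oe: (o e) => //.
- by move/(can_inj glueK)/(can_inj (resolveK a)).
- by move=> E; rewrite -E out in oe.
by move=> E; rewrite E out in od.
Qed.

Definition walk_perm a o (co : coherent a o) : {perm ldart D} := perm (walk_inj co).

Lemma vcircle_porbit a o (co : coherent a o) d e : o d -> o e ->
  (e \in vcircle a d) = (e \in porbit (walk_perm co) d).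
Proof.
move=> od oe; apply/idP/idP.
  (* Every edge has exactly one outgoing dart; [out] moves to it, since only outgoing darts are
     moved by the walk. *)
  pose out x := if o x then x else glue x.
  suff H x : x \in vcircle a d -> out x \in porbit (walk_perm co) d.
    by move/H; rewrite /out oe.
  rewrite inE; move: x.
  apply: (@generated_ind _ _ _ (fun x => out x \in _)) => [|y|y];
    first by rewrite /out od porbit_id.
    by rewrite /out (coherent_glue _ co); case: (o y); rewrite //= glueK.
  rewrite /out (coherent_resolve _ co); case oy: (o y) => /= H.
    by rewrite -(@mem_porbit_step _ _ _ y) permE /walk oy in H.
  have ogy : o (glue y) by rewrite (coherent_glue _ co) oy.
  rewrite -mem_porbit_step permE /walk (coherent_resolve _ co) oy /=.
  by rewrite resolveK.
have sub : porbit (walk_perm co) d \subset vcircle a d; last exact: (subsetP sub).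
apply: porbit_sub (mem_vcircle a d) => x; rewrite -!vcircle_eq permE /walk.
by case: (o x) => //; rewrite vcircle_glue vcircle_resolve.
Qed.

End Diagram.

(** * Switching one crossing *)

Section Toggle.
Variables (D : vlink) (o : {ffun ldart D -> bool}).
Implicit Types (a b : vertex D) (r s : crossing D) (d e : ldart D) (C : {set ldart D}).

Lemma vcircle_toggle_out a r d : (forall i, cdart r i \notin vcircle a d) ->
  vcircle (toggle a r) d = vcircle a d.
Proof.
move=> out; have other e : e \in vcircle a d -> resolve (toggle a r) e = resolve a e.
  by move=> ed; apply: resolve_toggle_other => i; apply: contraTneq ed => ->.
have closed b e x : x \in vcircle b e -> glue x \in vcircle b e /\ resolve b x \in
  vcircle b e.
  by rewrite -!vcircle_eq vcircle_glue vcircle_resolve.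
have sub : vcircle (toggle a r) d \subset vcircle a d.
  apply: vcircle_sub (mem_vcircle a d) _ _ => e ed; have [] := closed _ _ _ ed => //.
  by rewrite other.
apply/eqP; rewrite eqEsubset sub /=.
apply: vcircle_sub (mem_vcircle _ d) _ _ => e ed; have [] := closed _ _ _ ed => //.
by rewrite other ?(subsetP sub).
Qed.

Definition exit_circle a r (x : bool) : {set ldart D} := vcircle a (exit_dart o r x).

Lemma mem_exit_circle a r x d :
  (d \in exit_circle a r x) = (vcircle a d == exit_circle a r x).
Proof. by rewrite vcircle_eq. Qed.

Lemma cdart_circ a r i : alternating o r ->
  exists x, vcircle a (cdart r i) = exit_circle a r x.
Proof.
move=> alt; rewrite /exit_circle /exit_dart.
have eqc j k : resolve a (cdart r j) = cdart r k ->
  vcircle a (cdart r j) = vcircle a (cdart r k).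
  by move=> <-; rewrite vcircle_resolve.
case ar: (a r) (resolve_cdart a r) => -[[[/eqc e1 /eqc e2] /eqc e3] /eqc e4];
 case: (o _); case: (ord4P i) => ->;
 first [by exists true | by exists false | by exists true;
   congruence | by exists false; congruence].
Qed.

Lemma vcircle_meets a r d : alternating o r ->
  [exists i, cdart r i \in vcircle a d] = (d \in exit_circle a r true :|: exit_circle a
    r false).
Proof.
move=> alt; rewrite inE; apply/existsP/idP => [[i]|].
  rewrite -vcircle_eq => /eqP e; have [x] := cdart_circ a i alt.
  rewrite e => {}e; case: x e => e; apply/orP; [left|right]; by rewrite -e mem_vcircle.
by rewrite /exit_circle; case/orP; rewrite -vcircle_eq eq_sym vcircle_eq => m;
  eexists; apply: m.
Qed.

Lemma vcircle_toggle_neq a r d : alternating o r ->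
  d \notin exit_circle a r true :|: exit_circle a r false -> vcircle (toggle a r) d =
    vcircle a d.
Proof.
move=> alt; rewrite -vcircle_meets // negb_exists => /forallP.
exact: vcircle_toggle_out.
Qed.

Lemma circ_toggleU a r : alternating o r ->
  exit_circle (toggle a r) r true :|: exit_circle (toggle a r) r false
  = exit_circle a r true :|: exit_circle a r false.
Proof.
move=> alt; apply/setP => d; rewrite -!vcircle_meets //.
apply/idP/idP; apply: contraLR; rewrite negb_exists => /forallP H;
  have E := vcircle_toggle_out H; rewrite negb_exists; apply/forallP => i.
  by rewrite E.
by move: E; rewrite toggleK => ->.
Qed.

Definition separated a r : bool := exit_circle a r true != exit_circle a r false.

Lemma separatedE a r : separated a r = (exit_circle a r true != exit_circle a r false).
Proof. by []. Qed.

Lemma out_dart_exit r i : alternating o r -> o (cdart r i) ->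
  exists x, cdart r i = exit_dart o r x.
Proof.
rewrite /exit_dart => /and3P[/eqP o1 /eqP o2 o3].
case E: (o (cdart r bot_left)); case: (ord4P i) => -> oi.
- by exists true.
- by rewrite E oi in o3.
- by exists false.
- by rewrite E o2 oi in o3.
- by rewrite E in oi.
- by exists false.
- by rewrite -o1 E in oi.
by exists true.
Qed.

(** An orientation alternating at [r] leaves it only along the two exit darts, and the two
    resolutions differ in which incoming dart each of these is joined to. *)
Lemma walk_toggle a r (co : coherent a o) (co' : coherent (toggle a r) o) :
  alternating o r ->
  walk_perm co' = (tperm (exit_dart o r true) (exit_dart o r false) * walk_perm co)%g.
Proof.
move=> alt; apply/permP => d; rewrite permM [LHS]permE [RHS]permE /walk.
case: (eqVneq d (exit_dart o r true)) => [->|dt].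
  rewrite tpermL !exit_dart_out //; congr glue; rewrite /exit_dart.
  by case: (o _); rewrite !resolve_cdart ffunE eqxx; case: (a r).
case: (eqVneq d (exit_dart o r false)) => [->|df].
  rewrite tpermR !exit_dart_out //; congr glue; rewrite /exit_dart.
  by case: (o _); rewrite !resolve_cdart ffunE eqxx; case: (a r).
rewrite tpermD 1?eq_sym //.
case od: (o d) => //; congr glue; apply: resolve_toggle_other => i.
apply: contraNneq dt => di; rewrite di in od df *.
have [[] e] := out_dart_exit alt od; first by rewrite e.
by rewrite -e eqxx in df.
Qed.

(** A transposition always joins two cycles or cuts one. Hence a saddle at an alternating crossing
    is never non-orientable. *)
Lemma separated_toggle a r : coherent a o -> alternating o r ->
  separated (toggle a r) r = ~~ separated a r.
Proof.
move=> co alt; have co' := coherent_toggle co alt.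
rewrite /separated /exit_circle !vcircle_eq (vcircle_porbit co') ?exit_dart_out //
  (vcircle_porbit co) ?exit_dart_out //.
by rewrite (walk_toggle co) // mem_porbit_tperm // exit_dart_eq andbF.
Qed.

Lemma vcircle_toggle a r d : coherent a o -> alternating o r -> separated a r ->
  let U := exit_circle a r true :|: exit_circle a r false in
  vcircle (toggle a r) d = if d \in U then U else vcircle a d.
Proof.
move=> co alt sep U; case: ifPn => [dU|/vcircle_toggle_neq->//].
have /negPn/eqP e : ~~ separated (toggle a r) r by rewrite separated_toggle ?negbK.
have := circ_toggleU a alt; rewrite -/U e setUid => U_eq.
by apply: vcircle_id; rewrite // -U_eq vcircle_in.
Qed.

(** The two v-circles joined by both crossings are merged and cut again into two that recombine
    their halves, so exit darts that were together come apart. This crosswise pairing decides the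
    sign in [face_odd_double]. *)
Lemma circ_cross a r s : r != s -> coherent a o -> alternating o r -> alternating o s ->
  separated a r ->
  forall x y, exit_circle a s y = exit_circle a r x ->
    exit_circle a s (~~ y) = exit_circle a r (~~ x) ->
  exit_circle (toggle (toggle a s) r) s y != exit_circle (toggle (toggle a s) r) r x.
Proof.
move=> rs co altr alts sep x y e1 e2.
have co1 := coherent_toggle co alts; have co2 := coherent_toggle co1 altr.
have oE z := exit_dart_out z altr; have oE' z := exit_dart_out z alts.
rewrite /exit_circle vcircle_eq (vcircle_porbit co2) // (walk_toggle co1) //
  (walk_toggle co) //.
have tpermE t z : tperm (exit_dart o t true) (exit_dart o t false)
        = tperm (exit_dart o t z) (exit_dart o t (~~ z)).
  by case: z; rewrite // tpermC.
rewrite (tpermE r x) (tpermE s y).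
apply: porbit_tperm_cross; rewrite -?(vcircle_porbit co) // -?vcircle_eq.
- rewrite /= !inE !exit_dart_eq !negb_or (negPf rs) !eqxx /=.
  by case: (x); case: (y).
- by move: sep; rewrite /separated /exit_circle; case: (x); rewrite // eq_sym.
- exact/eqP.
exact/eqP.
Qed.

End Toggle.

(** * Anticommuting faces *)

Section Faces.
Variables (D : vlink) (ch : choices D) (o : {ffun ldart D -> bool}).
Implicit Types (a b : vertex D) (r s : crossing D) (d e : ldart D) (C : {set ldart D}).

Local Notation num := (numbering ch).
Local Notation circ := (exit_circle o).
Local Notation separated := (separated o).

Lemma numbering_perm a : perm_eq (num a) (enum (vcircles a)).
Proof. by case: ch. Qed.

Lemma numbering_uniq a : uniq (num a).
Proof. by rewrite (perm_uniq (numbering_perm a)) enum_uniq. Qed.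

Lemma mem_numbering a C : (C \in num a) = (C \in vcircles a).
Proof. by rewrite (perm_mem (numbering_perm a)) mem_enum. Qed.

Lemma mem_uninvolved a r C :
  (C \in uninvolved a r) = (C \in vcircles a) && ~~ involved r C.
Proof. by rewrite mem_enum inE. Qed.

Lemma uninvolved_uniq a r : uniq (uninvolved a r).
Proof. exact: enum_uniq. Qed.

Lemma involved_circ a r C : alternating o r -> C \in vcircles a ->
  involved r C = (C == circ a r true) || (C == circ a r false).
Proof.
move=> alt /vcirclesP[d ->]; rewrite /involved (vcircle_meets _ _ alt) inE.
by rewrite !mem_exit_circle.
Qed.

Lemma uninvolved_toggle a r : alternating o r ->
  uninvolved (toggle a r) r = uninvolved a r.
Proof.
move=> alt; rewrite /uninvolved; apply: (congr1 (fun A : {set {set ldart D}} => enum A)).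
apply/setP => C; rewrite !inE.
have sub b : C \in vcircles b -> ~~ involved r C -> C \in vcircles (toggle b r).
  case/vcirclesP => d ->; rewrite /involved negb_exists => /forallP out.
  by rewrite -(vcircle_toggle_out out) vcircle_in.
by apply/andP/andP => -[Cb inv]; split=> //; have := sub _ Cb inv; rewrite ?toggleK.
Qed.

Lemma circ_in a r x : circ a r x \in vcircles a.
Proof. exact: vcircle_in. Qed.

Lemma numbering_pair a r P Q :
  P \in vcircles a -> Q \in vcircles a -> P != Q ->
  (forall C, C \in vcircles a -> involved r C = (C == P) || (C == Q)) ->
  perm_eq (num a) [:: P, Q & uninvolved a r].
Proof.
move=> Pa Qa PQ inv; apply: uniq_perm; first exact: numbering_uniq.
  by rewrite /= uninvolved_uniq !inE !mem_uninvolved !inv // !eqxx orbT !andbF (negPf PQ).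
move=> C; rewrite mem_numbering !inE mem_uninvolved.
case: (boolP (C \in _)) => [Ca|] /=; first by rewrite inv //; do 2!case: (C == _).
by move=> Ca; apply/esym/norP; split; [|rewrite orbF]; apply: contraNneq Ca => ->.
Qed.

Lemma numbering_single a r P : P \in vcircles a ->
  (forall C, C \in vcircles a -> involved r C = (C == P)) ->
  perm_eq (num a) (P :: uninvolved a r).
Proof.
move=> Pa inv; apply: uniq_perm; first exact: numbering_uniq.
  by rewrite /= uninvolved_uniq mem_uninvolved inv // eqxx andbF.
move=> C; rewrite mem_numbering !inE mem_uninvolved.
case: (boolP (C \in _)) => [Ca|] /=; first by rewrite inv //; case: (C == _).
by move=> Ca; rewrite orbF; apply/esym; apply: contraNF Ca => /eqP->.
Qed.

Lemma numbering_sep a r x : alternating o r -> separated a r ->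
  perm_eq (num a) [:: circ a r x, circ a r (~~ x) & uninvolved a r].
Proof.
move=> alt sep; apply: numbering_pair; rewrite ?circ_in //; first by case: x;
  rewrite // eq_sym.
by move=> C Ca; rewrite (involved_circ alt Ca); case: x; rewrite // orbC.
Qed.

Lemma numbering_nsep a r x : alternating o r -> ~~ separated a r ->
  perm_eq (num a) (circ a r x :: uninvolved a r).
Proof.
move=> alt /negPn/eqP nsep; apply: numbering_single; rewrite ?circ_in // => C Ca.
by rewrite (involved_circ alt Ca) nsep orbb; case: x; rewrite ?nsep.
Qed.

(* Sign exponent of the edge of the cube at [a] in direction [r], relative to
   the v-circles through the two exit darts; it does not see which end of the
   edge is the 0-resolution. *)
Definition edge_odd a r x : bool :=
  if separated a r then
    merge_odd (num a) (num (toggle a r)) (circ a r x) (circ a r (~~ x))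
      (circ (toggle a r) r x) (uninvolved a r)
  else
    merge_odd (num (toggle a r)) (num a) (circ (toggle a r) r x)
      (circ (toggle a r) r (~~ x)) (circ a r x) (uninvolved a r).

Lemma edge_odd_toggle a r x : coherent a o -> alternating o r ->
  edge_odd (toggle a r) r x = edge_odd a r x.
Proof.
move=> co alt; rewrite /edge_odd separated_toggle // toggleK uninvolved_toggle //.
by case: separated.
Qed.

Lemma edge_oddN a r x : coherent a o -> alternating o r ->
  edge_odd a r (~~ x) = ~~ edge_odd a r x.
Proof.
move=> co alt; rewrite /edge_odd negbK; have sepN := separated_toggle co alt.
have nsepE b : ~~ separated b r -> circ b r (~~ x) = circ b r x.
  by move/negPn/eqP => e; case: x.
case sep : (separated a r) sepN => /= sepN.
  rewrite (nsepE (toggle a r)) ?sepN // [LHS]merge_oddC ?numbering_uniq //.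
  exact: numbering_sep.
rewrite (nsepE a) ?sep // [LHS]merge_oddC ?numbering_uniq //.
by rewrite -(uninvolved_toggle _ alt); apply: numbering_sep.
Qed.

(** True when the two paths around the square have opposite signs. Each of [x] and [y] enters two of
    the four edges, so the value does not depend on them. *)
Definition face_odd a r s x y : bool :=
  (edge_odd a r x (+) edge_odd (toggle a r) s y)
  (+) (edge_odd a s y (+) edge_odd (toggle a s) r x).

Lemma circ_toggle a r s x : coherent a o -> alternating o r -> separated a r ->
  circ (toggle a r) s x =
    if (circ a s x == circ a r true) || (circ a s x == circ a r false)
    then circ a r true :|: circ a r false else circ a s x.
Proof.
move=> co alt sep; rewrite {1}/exit_circle (vcircle_toggle _ co) // inE.
by rewrite !mem_exit_circle.
Qed.

Lemma circ_merge a r x : coherent a o -> alternating o r -> separated a r ->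
  circ (toggle a r) r x = circ a r x :|: circ a r (~~ x).
Proof.
by move=> co alt sep; rewrite circ_toggle //; case: x; rewrite eqxx ?orbT // setUC.
Qed.

(** A v-circle equal to the union would contain both exit darts and so coincide with both exit
    circles. *)
Lemma circ_neq_union a r x C : separated a r -> C \in vcircles a ->
  C != circ a r x :|: circ a r (~~ x).
Proof.
move=> sep Ca; apply: contra sep => /eqP eC.
have E z : circ a r z = C.
  apply: vcircle_id => //; rewrite eC in_setU.
  by rewrite /exit_circle; case: (x); case: z; rewrite mem_vcircle ?orbT.
by rewrite !E.
Qed.

Lemma edge_odd_sep a r x u : coherent a o -> alternating o r -> separated a r ->
  perm_eq (uninvolved a r) u ->
  edge_odd a r x = merge_odd (num a) (num (toggle a r)) (circ a r x)
    (circ a r (~~ x)) (circ (toggle a r) r x) u.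
Proof.
move=> co alt sep pu; rewrite /edge_odd sep; apply: merge_odd_perm => //.
- exact: numbering_sep.
- exact: numbering_uniq.
- rewrite -(uninvolved_toggle _ alt); apply: numbering_nsep => //.
  by rewrite separated_toggle // negbK.
exact: numbering_uniq.
Qed.

Lemma edge_odd_nsep a r x u : coherent a o -> alternating o r -> ~~ separated a r ->
  perm_eq (uninvolved a r) u ->
  edge_odd a r x = merge_odd (num (toggle a r)) (num a) (circ (toggle a r) r x)
    (circ (toggle a r) r (~~ x)) (circ a r x) u.
Proof.
move=> co alt sep pu; have co' := coherent_toggle co alt.
have sep' : separated (toggle a r) r by rewrite (separated_toggle co alt).
have pu' : perm_eq (uninvolved (toggle a r) r) u by rewrite uninvolved_toggle.
by rewrite -(edge_odd_toggle _ co alt) (edge_odd_sep _ co' alt sep' pu') toggleK.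
Qed.

Lemma face_oddC a r s x y : face_odd a r s x y = face_odd a s r y x.
Proof. by rewrite /face_odd addbC. Qed.

Lemma face_oddN a r s x y : coherent a o -> alternating o r -> alternating o s ->
  face_odd a r s (~~ x) y = face_odd a r s x y.
Proof.
move=> co altr alts; rewrite /face_odd !edge_oddN ?coherent_toggle //.
by do 4!case: edge_odd.
Qed.

(** Seen from another corner the square has the same four edges; this is the use of an edge sign
    without direction. *)
Lemma face_odd_toggle a r s x y : coherent a o -> alternating o r -> alternating o s ->
  face_odd (toggle a r) r s x y = face_odd a r s x y.
Proof.
move=> co altr alts; have co2 := coherent_toggle co alts.
rewrite /face_odd toggleK toggleC (edge_odd_toggle _ co altr) (edge_odd_toggle _ co2
  altr).
move: (edge_odd a r x) (edge_odd a s y) (edge_odd (toggle a r) s y) => b1 b2 b3.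
by move: (edge_odd _ r x) => b4; case: b1 b2 b3 b4 => [] [] [] [].
Qed.

(** * Faces whose two saddles at the base corner are merges *)

Section SeparatedFace.
Variables (a : vertex D) (r s : crossing D).
Hypotheses (rs : r != s) (co : coherent a o) (altr : alternating o r)
  (alts : alternating o s) (sepr : separated a r) (seps : separated a s).

Let neq_circ b t x : separated b t -> circ b t x != circ b t (~~ x).
Proof. by case: x; rewrite // eq_sym. Qed.

Let perm_del2 (T : eqType) (p q : T) (u v : seq T) :
  perm_eq [:: p, q & u] [:: p, q & v] -> perm_eq u v.
Proof. by rewrite !perm_cons. Qed.

Let perm_del1 (T : eqType) (p : T) (u v : seq T) :
  perm_eq (p :: u) (p :: v) -> perm_eq u v.
Proof. by rewrite perm_cons. Qed.

Let circU b t z : circ b t true :|: circ b t false = circ b t z :|: circ b t (~~ z).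
Proof. by case: z => //; rewrite setUC. Qed.

Let circ_pair b t z : (circ b t z == circ b t true) || (circ b t z == circ b t false).
Proof. by case: z; rewrite eqxx ?orbT. Qed.

Lemma face_odd_disjoint x y :
  (forall z t, circ a r z != circ a s t) -> face_odd a r s x y.
Proof.
move=> dis.
have co1 := coherent_toggle co altr; have co2 := coherent_toggle co alts.
set A := circ a r x; set B := circ a r (~~ x).
set C := circ a s y; set E := circ a s (~~ y).
have [AB CE] : A != B /\ C != E by split; apply: neq_circ.
have s1 z : circ (toggle a r) s z = circ a s z.
  by rewrite circ_toggle // ![circ a s z == _]eq_sym !(negPf (dis _ _)).
have r2 z : circ (toggle a s) r z = circ a r z.
  by rewrite circ_toggle // !(negPf (dis _ _)).
have seps1 : separated (toggle a r) s by rewrite separatedE !s1.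
have sepr2 : separated (toggle a s) r by rewrite separatedE !r2.
(* The v-circles away from both crossings, which are common to the four corners. *)
pose u := [seq X <- num a | X \notin [:: A; B; C; E]].
have e0 : perm_eq (num a) [:: A, B, C, E & u].
  apply: uniq_perm; first exact: numbering_uniq.
    rewrite /= !inE !mem_filter !inE !eqxx ?orbT /= !(negPf (dis _ _)) (negPf AB)
      (negPf CE) /=.
    by rewrite filter_uniq // numbering_uniq.
  move=> X; rewrite !inE mem_filter !inE mem_numbering.
  case: (eqVneq X A) => [->|_]; first by rewrite circ_in.
  case: (eqVneq X B) => [->|_]; first by rewrite circ_in.
  case: (eqVneq X C) => [->|_]; first by rewrite circ_in.
  by case: (eqVneq X E) => [->|_]; first by rewrite circ_in.
have swap4 (p q p' q' : {set ldart D}) v : perm_eq [:: p, q, p', q' & v] [:: p', q', p,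
  q & v].
  exact: (permEl (perm_catCA [:: p; q] [:: p'; q'] v)).
have swap3 (p q p' : {set ldart D}) v : perm_eq [:: p, q, p' & v] [:: q, p', p & v].
  exact: (permEl (perm_catCA [:: p] [:: q; p'] v)).
have ur : perm_eq (uninvolved a r) [:: C, E & u].
  apply: (@perm_del2 _ A B); apply: perm_trans e0.
  by rewrite perm_sym numbering_sep.
have us : perm_eq (uninvolved a s) [:: A, B & u].
  apply: (@perm_del2 _ C E); apply: perm_trans (swap4 _ _ _ _ _).
  by apply: perm_trans e0; rewrite perm_sym numbering_sep.
set AB' := circ (toggle a r) r x; set CE' := circ (toggle a s) s y.
have e1 : perm_eq (num (toggle a r)) [:: AB', C, E & u].
  apply: (@perm_trans _ (AB' :: uninvolved a r)); last by rewrite perm_cons.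
  rewrite -(uninvolved_toggle _ altr) numbering_nsep // separated_toggle //.
  by rewrite negbK.
have e2 : perm_eq (num (toggle a s)) [:: CE', A, B & u].
  apply: (@perm_trans _ (CE' :: uninvolved a s)); last by rewrite perm_cons.
  rewrite -(uninvolved_toggle _ alts) numbering_nsep // separated_toggle //.
  by rewrite negbK.
have u1 : perm_eq (uninvolved (toggle a r) s) (AB' :: u).
  apply: (@perm_del2 _ C E); apply: perm_trans (swap3 _ _ _ _).
  by apply: perm_trans e1; rewrite perm_sym /C /E -!s1 numbering_sep.
have u2 : perm_eq (uninvolved (toggle a s) r) (CE' :: u).
  apply: (@perm_del2 _ A B); apply: perm_trans (swap3 _ _ _ _).
  by apply: perm_trans e2; rewrite perm_sym /A /B -!r2 numbering_sep.
have m1 : circ (toggle (toggle a r) s) s y = CE' by rewrite /CE' !circ_merge // !s1.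
have m2 : circ (toggle (toggle a s) r) r x = AB' by rewrite /AB' !circ_merge // !r2.
have e12 : perm_eq (num (toggle (toggle a r) s)) [:: AB', CE' & u].
  apply: (@perm_trans _ [:: CE', AB' & u]); last exact: (permEl (perm_catCA [:: CE']
    [:: AB'] u)).
  apply: (@perm_trans _ (CE' :: uninvolved (toggle a r) s)); last by rewrite perm_cons.
  rewrite -(uninvolved_toggle _ alts) -m1 numbering_nsep // separated_toggle //.
  by rewrite negbK.
rewrite /face_odd (edge_odd_sep _ co altr sepr ur) (edge_odd_sep _ co alts seps us).
rewrite (edge_odd_sep _ co1 alts seps1 u1) (edge_odd_sep _ co2 altr sepr2 u2).
rewrite m1 m2 !s1 !r2 (toggleC a s r).
by apply: face_disjoint; rewrite ?numbering_uniq.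
Qed.

(** The crossings share exactly one v-circle, so three v-circles become one along either path and
    [face_chain] applies. *)
Lemma face_odd_chain x y : circ a r (~~ x) = circ a s y ->
  (forall z, circ a r z != circ a s (~~ y)) -> face_odd a r s x y.
Proof.
move=> eB dis.
have co1 := coherent_toggle co altr; have co2 := coherent_toggle co alts.
set A := circ a r x; set B := circ a s y; set C := circ a s (~~ y).
have BC : B != C by apply: neq_circ.
have AB : A != B by rewrite /B -eB; apply: neq_circ.
have AC : A != C := dis x.
have E1y : circ (toggle a r) s y = A :|: B.
  by rewrite circ_toggle // /A /B -eB circ_pair (circU a r x).
have E1C : circ (toggle a r) s (~~ y) = C.
  by rewrite circ_toggle // ![circ a s (~~ y) == _]eq_sym !(negPf (dis _)).
have E2x : circ (toggle a s) r (~~ x) = B :|: C.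
  by rewrite circ_toggle // eB circ_pair (circU a s y).
have AneB z : A != circ a s z.
  by have [->|->] : z = y \/ z = ~~ y by case: (z); case: (y); auto.
have E2A : circ (toggle a s) r x = A.
  by rewrite circ_toggle // !(negPf (AneB _)).
have sepE b t z : (circ b t z != circ b t (~~ z)) = separated b t.
  by case: z; rewrite // eq_sym.
have seps1 : separated (toggle a r) s.
  rewrite -(sepE _ _ y) E1y E1C eq_sym /A /B -eB.
  by apply: circ_neq_union => //; apply: circ_in.
have sepr2 : separated (toggle a s) r.
  rewrite -(sepE _ _ x) E2x E2A.
  by apply: circ_neq_union => //; apply: circ_in.
pose u := [seq X <- num a | X \notin [:: A; B; C]].
have e0 : perm_eq (num a) [:: A, B, C & u].
  apply: uniq_perm; first exact: numbering_uniq.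
    rewrite /= !inE !mem_filter !inE !eqxx ?orbT /= (negPf AB) (negPf AC) (negPf BC) /=.
    by rewrite filter_uniq // numbering_uniq.
  move=> X; rewrite !inE mem_filter !inE mem_numbering.
  case: (eqVneq X A) => [->|_]; first by rewrite circ_in.
  case: (eqVneq X B) => [->|_]; first by rewrite circ_in.
  by case: (eqVneq X C) => [->|_]; first by rewrite circ_in.
have swap3 (p q p' : {set ldart D}) v : perm_eq [:: p, q, p' & v] [:: q, p', p & v].
  exact: (permEl (perm_catCA [:: p] [:: q; p'] v)).
have swap2 (p q : {set ldart D}) v : perm_eq [:: p, q & v] [:: q, p & v].
  exact: (permEl (perm_catCA [:: p] [:: q] v)).
have ur : perm_eq (uninvolved a r) (C :: u).
  apply: (@perm_del2 _ A B); apply: perm_trans e0.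
  by rewrite perm_sym /B -eB numbering_sep.
have us : perm_eq (uninvolved a s) (A :: u).
  apply: (@perm_del2 _ B C); apply: perm_trans (swap3 _ _ _ _).
  by apply: perm_trans e0; rewrite perm_sym numbering_sep.
set AB' := circ (toggle a r) r x; set BC' := circ (toggle a s) s y.
have mAB : circ (toggle a r) s y = AB' by rewrite E1y /AB' circ_merge // eB.
have mBC : circ (toggle a s) r (~~ x) = BC' by rewrite E2x /BC' circ_merge.
have e1 : perm_eq (num (toggle a r)) [:: AB', C & u].
  apply: (@perm_trans _ (AB' :: uninvolved a r)); last by rewrite perm_cons.
  rewrite -(uninvolved_toggle _ altr) numbering_nsep // separated_toggle //.
  by rewrite negbK.
have e2 : perm_eq (num (toggle a s)) [:: BC', A & u].
  apply: (@perm_trans _ (BC' :: uninvolved a s)); last by rewrite perm_cons.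
  rewrite -(uninvolved_toggle _ alts) numbering_nsep // separated_toggle //.
  by rewrite negbK.
have u1 : perm_eq (uninvolved (toggle a r) s) u.
  apply: (@perm_del2 _ AB' C); apply: perm_trans e1.
  by rewrite perm_sym -mAB -E1C numbering_sep.
have u2 : perm_eq (uninvolved (toggle a s) r) u.
  apply: (@perm_del2 _ A BC'); apply: perm_trans (swap2 _ _ _).
  apply: perm_trans e2; rewrite perm_sym.
  by have := numbering_sep x altr sepr2; rewrite E2A mBC.
set ABC := circ (toggle (toggle a r) s) s y.
have m2 : circ (toggle (toggle a s) r) r x = ABC.
  by rewrite /ABC !circ_merge // E1y E1C E2x E2A setUA.
have e12 : perm_eq (num (toggle (toggle a r) s)) (ABC :: u).
  apply: (@perm_trans _ (ABC :: uninvolved (toggle a r) s)); last by rewrite perm_cons.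
  rewrite -(uninvolved_toggle _ alts) numbering_nsep // separated_toggle //.
  by rewrite negbK.
rewrite /face_odd (edge_odd_sep _ co altr sepr ur) (edge_odd_sep _ co alts seps us).
rewrite (edge_odd_sep _ co1 alts seps1 u1) (edge_odd_sep _ co2 altr sepr2 u2).
rewrite m2 mAB mBC E1C E2A eB (toggleC a s r).
by apply: face_chain; rewrite ?numbering_uniq.
Qed.

(** Each path merges two v-circles and splits the result. The orderings cancel except that of the
    final two v-circles, which the two paths list in opposite orders. *)
Lemma face_odd_double x y : circ a s y = circ a r x ->
  circ a s (~~ y) = circ a r (~~ x) -> face_odd a r s x y.
Proof.
move=> eA eB.
have co1 := coherent_toggle co altr; have co2 := coherent_toggle co alts.
have co12 := coherent_toggle co1 alts.
set A := circ a r x; set B := circ a r (~~ x).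
set AB' := circ (toggle a r) r x.
have AB_eq : AB' = A :|: B by rewrite /AB' circ_merge.
have s1 z : circ (toggle a r) s z = AB'.
  rewrite circ_toggle // AB_eq (circU a r x).
  by have [->|->] : z = y \/ z = ~~ y by [case: (z); case: (y); auto];
    rewrite ?eA ?eB circ_pair.
have r2 z : circ (toggle a s) r z = AB'.
  rewrite circ_toggle // AB_eq (circU a s y) /A /B -eA -eB.
  by have [->|->] : z = x \/ z = ~~ x by [case: (z); case: (x); auto];
    rewrite -?eA -?eB circ_pair.
have nseps1 : ~~ separated (toggle a r) s by rewrite separatedE !s1 eqxx.
have nsepr2 : ~~ separated (toggle a s) r by rewrite separatedE !r2 eqxx.
have m2 : circ (toggle a s) s y = AB' by rewrite circ_merge // eA eB AB_eq.
set P := circ (toggle (toggle a r) s) s y; set Q := circ (toggle (toggle a r) s) s (~~ y).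
have sep12s : separated (toggle (toggle a r) s) s by rewrite separated_toggle.
have sep12r : separated (toggle (toggle a r) s) r by rewrite toggleC separated_toggle.
pose u := uninvolved a r.
have ur : perm_eq (uninvolved a r) u by [].
have us : perm_eq (uninvolved a s) u.
  apply: (@perm_del2 _ A B); rewrite /A -eA /B -eB.
  apply: (@perm_trans _ (num a)); first by rewrite perm_sym numbering_sep.
  by rewrite eA eB numbering_sep.
have e1 : perm_eq (num (toggle a r)) (AB' :: u).
  rewrite /u -(uninvolved_toggle _ altr) numbering_nsep // separated_toggle //.
  by rewrite negbK.
have e2 : perm_eq (num (toggle a s)) (AB' :: u).
  apply: (@perm_trans _ (AB' :: uninvolved a s)); last by rewrite perm_cons.
  rewrite -(uninvolved_toggle _ alts) -m2 numbering_nsep // separated_toggle //.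
  by rewrite negbK.
have u1 : perm_eq (uninvolved (toggle a r) s) u.
  apply: (@perm_del1 _ AB'); apply: perm_trans e1.
  by rewrite perm_sym -(s1 y) numbering_nsep.
have u2 : perm_eq (uninvolved (toggle a s) r) u.
  apply: (@perm_del1 _ AB'); apply: perm_trans e2.
  by rewrite perm_sym -(r2 x) numbering_nsep.
have e12 : perm_eq (num (toggle (toggle a r) s)) [:: P, Q & u].
  apply: (@perm_trans _ [:: P, Q & uninvolved (toggle a r) s]).
    by rewrite -(uninvolved_toggle _ alts) numbering_sep.
  by rewrite !perm_cons.
(* The two diagonal ends pair the four exit darts differently. *)
have cross : P != circ (toggle (toggle a r) s) r x.
  by rewrite /P toggleC; apply: circ_cross.
have rPQ z : circ (toggle (toggle a r) s) r z \in [:: P; Q].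
  have : circ (toggle (toggle a r) s) r z \in num (toggle (toggle a r) s).
    by rewrite mem_numbering circ_in.
  rewrite (perm_mem e12) !inE orbA => /orP[//|]; rewrite mem_uninvolved => /andP[_].
  by rewrite (involved_circ altr (circ_in _ _ _)) negb_or; case: z; rewrite eqxx ?andbF.
have rx : circ (toggle (toggle a r) s) r x = Q.
  by have := rPQ x; rewrite !inE [_ == P]eq_sym (negPf cross) /= => /eqP.
have rx' : circ (toggle (toggle a r) s) r (~~ x) = P.
  have := rPQ (~~ x); rewrite !inE => /orP[/eqP //|]; rewrite -rx.
  by rewrite eq_sym (negPf (neq_circ x sep12r)).
rewrite /face_odd (edge_odd_sep _ co altr sepr ur) (edge_odd_sep _ co alts seps us).
rewrite (edge_odd_nsep _ co1 alts nseps1 u1) (edge_odd_nsep _ co2 altr nsepr2 u2).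
rewrite (toggleC a s r) rx rx' m2 eA eB s1 r2 -/P -/Q -/A -/B -/AB'.
rewrite addbACA /merge_odd -!/(merge_odd _ _ _ _ _ _).
rewrite [merge_odd _ (num (toggle a s)) Q P _ _]merge_oddC ?numbering_uniq //.
rewrite /merge_odd.
move: (cmp_odd (num a) _) (cmp_odd (num (toggle a r)) _) (cmp_odd (num (toggle a s)) _).
by move: (cmp_odd _ _) => b1 b2 b3 b4; case: b1 b2 b3 b4 => [] [] [] [].
Qed.

Lemma face_odd_separated x y : face_odd a r s x y.
Proof.
(* As the parity ignores [x] and [y], they may be replaced by values that name the shared
   v-circle. *)
have flip1 z t : face_odd a r s z t -> face_odd a r s x t.
  by have [->|->] : z = x \/ z = ~~ x; [case: (z); case: (x); auto | | rewrite face_oddN].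
have flip2 z t : face_odd a r s z t -> face_odd a r s z y.
  rewrite !(face_oddC a r).
  by have [->|->] : t = y \/ t = ~~ y; [case: (t); case: (y); auto | | rewrite face_oddN].
case: (boolP [exists z, [exists t, circ a r z == circ a s t]]); last first.
  rewrite negb_exists => /forallP dis; apply: face_odd_disjoint => z t.
  by have := dis z; rewrite negb_exists => /forallP.
case/existsP => z /existsP[t /eqP e].
case: (eqVneq (circ a r (~~ z)) (circ a s (~~ t))) => [e'|ne].
  by apply: flip1 (flip2 _ t _); apply: face_odd_double (esym e) (esym e').
apply: flip1 (flip2 (~~ z) t _); apply: face_odd_chain => [|w]; first by rewrite negbK.
have [->|->] : w = z \/ w = ~~ z by case: (w); case: (z); auto.
  by rewrite e; apply: neq_circ.
by [].
Qed.

End SeparatedFace.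

(** A merge elsewhere cannot tear apart the single v-circle through both exit darts of [s]. *)
Lemma nseparated_toggle a r s : coherent a o -> alternating o r ->
  separated a r -> ~~ separated a s -> ~~ separated (toggle a r) s.
Proof.
move=> co alt sepr /negPn/eqP e; apply/negPn/eqP.
by rewrite !circ_toggle // e.
Qed.

Lemma face_oddP a r s x y : r != s -> coherent a o -> alternating o r ->
  alternating o s -> face_odd a r s x y.
Proof.
move=> rs co altr alts.
wlog sepr : a co / separated a r => [H|].
  case: (boolP (separated a r)) => [/H->//|nsepr].
  rewrite -(face_odd_toggle _ _ co altr alts); apply: H; first exact: coherent_toggle.
  by rewrite separated_toggle.
case: (boolP (separated a s)) => [seps|nseps]; first exact: face_odd_separated.
have cos := coherent_toggle co alts; have cor := coherent_toggle co altr.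
have seps : separated (toggle a s) s by rewrite separated_toggle.
rewrite face_oddC -(face_odd_toggle _ _ co alts altr) face_oddC.
(* If switching [s] turns [r] into a split, the corner opposite to [a] has two merges: [r] is
   switched as well, and [s], still not separated after the merge at [r], becomes separated when
   switched. *)
case: (boolP (separated (toggle a s) r)) => [sepr'|nsepr'];
  first exact: face_odd_separated.
rewrite -(face_odd_toggle _ _ cos altr alts); apply: face_odd_separated => //.
- exact: coherent_toggle.
- by rewrite separated_toggle.
by rewrite toggleC separated_toggle // nseparated_toggle.
Qed.

Lemma size_numbering_toggle a r : coherent a o -> alternating o r ->
  (size (num a) + (~~ separated a r) = size (num (toggle a r)) + separated a r)%N.
Proof.
move=> co alt; have sepN := separated_toggle co alt.
case: (boolP (separated a r)) sepN => sep sepN.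
  rewrite (perm_size (numbering_sep true alt sep)).
  by rewrite (perm_size (numbering_nsep true alt (negbT sepN))) uninvolved_toggle //=
    addn0 addn1.
rewrite (perm_size (numbering_nsep true alt sep)).
by rewrite (perm_size (numbering_sep true alt sepN)) uninvolved_toggle //= addn0 addn1.
Qed.

(** The number of v-circles depends only on the corner, so both paths to the opposite corner change
    it equally. This balances the powers of 2 on the two paths. *)
Lemma separated_face a r s : coherent a o -> alternating o r -> alternating o s ->
  (separated a r + separated (toggle a r) s = separated a s + separated (toggle a s) r)%N.
Proof.
move=> co altr alts.
have := size_numbering_toggle co altr; have := size_numbering_toggle co alts.
have := size_numbering_toggle (coherent_toggle co altr) alts.
have := size_numbering_toggle (coherent_toggle co alts) altr.
rewrite (toggleC a s r); move: (size _) (size _) (size _) (size _) => n1 n2 n3 n4.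
by do 4!case: separated; lia.
Qed.

End Faces.

Local Open Scope ring_scope.

(** * Saddles in the basis of colours *)

Section ColorBasis.
Variables (D : vlink) (ch : choices D).
Implicit Types (a b : vertex D) (r s : crossing D) (d e : ldart D) (C : {set ldart D}).
Implicit Types o : {ffun ldart D -> bool}.

Local Notation num := (numbering ch).

Lemma orient_glue a d : orient ch a (glue d) = ~~ orient ch a d.
Proof. by case: ch. Qed.

Lemma orient_resolve a d : orient ch a (resolve a d) = ~~ orient ch a d.
Proof. by case: ch. Qed.

Definition orientation a : {ffun ldart D -> bool} := [ffun d => orient ch a d].

Lemma coherent_orientation a : coherent a (orientation a).
Proof. by apply/coherentP => d; rewrite !ffunE orient_glue orient_resolve. Qed.

Lemma coherent_addb a o o' d e : coherent a o -> coherent a o' ->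
  e \in vcircle a d -> o e (+) o' e = o d (+) o' d.
Proof.
move=> co co'; rewrite inE; move: e.
apply: (@generated_ind _ _ _ (fun e => o e (+) o' e = o d (+) o' d)) => // e IH.
  by rewrite !(coherent_glue _ co) !(coherent_glue _ co') addbN addNb negbK.
by rewrite !(coherent_resolve _ co) !(coherent_resolve _ co') addbN addNb negbK.
Qed.

(* [flipped a o C]: on the v-circle [C], [o] is opposite to the chosen
   orientation, so that [o] puts the colour 1 - X on [C], and 1 + X otherwise. *)
Definition flipped a o C : bool := [exists d in C, o d != orient ch a d].

Lemma flippedE a o C d : coherent a o -> C \in vcircles a -> d \in C ->
  flipped a o C = (o d (+) orient ch a d).
Proof.
move=> co Ca dC; have E e : e \in C -> o e (+) orient ch a e = o d (+) orient ch a d.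
  rewrite -(vcircle_id Ca dC) => /(coherent_addb co (coherent_orientation a)).
  by rewrite !ffunE.
apply/existsP/idP => [[e /andP[eC ne]]|ne].
  by rewrite -(E e eC); move: ne; do 2!case: (_ e).
by exists d; rewrite dC; move: ne; do 2!case: (_ d).
Qed.

Section Coefficients.
Variable R : comPzRingType.

Definition color_coef a o (v : word ch a) : R :=
  \prod_(C <- num a) (-1) ^+ (letter v C && flipped a o C).

Lemma sum_word a (g : {set ldart D} -> bool -> R) :
  \sum_(v : word ch a) \prod_(C <- num a) g C (letter v C)
  = \prod_(C <- num a) (g C false + g C true).
Proof.
have toI (F : {set ldart D} -> R) :
    \prod_(C <- num a) F C = \prod_(i < size (num a)) F (nth set0 (num a) i).
  by rewrite (big_nth set0) big_mkord.
rewrite toI; under [RHS]eq_bigr => i _ do rewrite addrC -(big_bool _ (g _)).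
rewrite bigA_distr_bigA /=.
rewrite (reindex (fun f : {ffun 'I_(size (num a)) -> bool} => [tuple f i | i < size
  (num a)])) /=.
  apply: eq_bigr => f _; rewrite toI; apply: eq_bigr => i _.
  rewrite /letter index_uniq ?numbering_uniq //; congr (g _ _).
  by rewrite -(tnth_nth false [tuple f i | i < size (num a)]) tnth_mktuple.
exists (fun v => [ffun i => tnth v i]) => [f _|v _].
  by apply/ffunP => i; rewrite ffunE tnth_mktuple.
by apply: eq_from_tnth => i; rewrite tnth_mktuple ffunE.
Qed.

(** Phi exchanges 1 + X and 1 - X, hence adds its bit to the colour. *)
Lemma Phi_if_color (n f x : bool) :
  Phi_if R n false x + (-1) ^+ f * Phi_if R n true x = (-1) ^+ (x && (f (+) n)).
Proof. by case: n f x => [] [] []; rewrite /Phi_if /=; ring. Qed.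

(** The colour and the decoration by Phi both refer to the chosen orientation, which cancels: what
    remains compares [o] with the standard orientation. *)
Lemma nonstdE a o r C k j : coherent a o -> C \in vcircles a -> cdart r j \in C ->
  (forall i, cdart r i \in C -> (o (cdart r i) != std_out i) = k) ->
  flipped a o C (+) nonstd ch a r C = k.
Proof.
move=> co Ca jC H; rewrite (flippedE co Ca jC) -(H j jC).
have -> : nonstd ch a r C = (orient ch a (cdart r j) != std_out j).
  apply/existsP/idP => [[i /andP[iC ne]]|ne]; last by exists j; rewrite jC.
  have := flippedE co Ca jC; rewrite (flippedE co Ca iC).
  have := H j jC; rewrite -(H i iC); move: ne.
  by do 2!case: (o _); do 2!case: (orient _ _ _); do 2!case: std_out.
by case: (o _); case: (orient _ _ _); case: std_out.
Qed.

(** On an uninvolved v-circle Phi translates the colour from the orientation chosen at [a] to the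
    one chosen at [b], so that [o] is preserved. *)
Lemma disagreeE a b o C : coherent a o -> coherent b o ->
  C \in vcircles a -> C \in vcircles b ->
  flipped a o C (+) disagree ch a b C = flipped b o C.
Proof.
move=> coa cob Ca Cb; case/vcirclesP: (Ca) => d Cd.
have dC : d \in C by rewrite Cd mem_vcircle.
rewrite (flippedE cob Cb dC).
have -> : disagree ch a b C = orient ch a d (+) orient ch b d.
  have E e : e \in C -> orient ch a e (+) orient ch b e = orient ch a d (+) orient ch b d.
    move=> eC; have := flippedE coa Ca eC; rewrite (flippedE coa Ca dC).
    have := flippedE cob Cb eC; rewrite (flippedE cob Cb dC).
    by do 2!case: (o _); do 2!case: (orient _ a _); do 2!case: (orient _ b _).
  apply/existsP/idP => [[e /andP[eC ne]]|ne].
    by rewrite -(E e eC); move: ne; do 2!case: (orient _ _ e).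
  by exists d; rewrite dC; move: ne; do 2!case: (orient _ _ d).
by rewrite (flippedE coa Ca dC); case: (o d); do 2!case: (orient _ _ d).
Qed.

(** The factor 2 is that of (1 + X)^2 = 2 (1 + X) and (1 - X)^2 = 2 (1 - X). *)
Definition edge_coef o a r : R :=
  (-1) ^+ edge_odd ch o a r true * 2%:R ^+ separated o a r.

Lemma edge_coefE o a r :
  edge_coef o a r = (-1) ^+ edge_odd ch o a r true * 2%:R ^+ separated o a r.
Proof. by []. Qed.

Definition rest_coef a b r (v : word ch a) (w : word ch b) : R :=
  \prod_(E <- uninvolved a r) Phi_if R (disagree ch a b E) (letter v E) (letter w E).

(** The summand is a product of local factors [g], one for each v-circle, so the sum over words
    becomes a product of sums over one letter. *)
Lemma sum_rest_single a b o r (w : word ch b) P n x :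
  perm_eq (num a) (P :: uninvolved a r) ->
  \sum_(v : word ch a) color_coef o v * (Phi_if R n (letter v P) x * rest_coef r v w)
  = (-1) ^+ (x && (flipped a o P (+) n))
    * \prod_(E <- uninvolved a r)
        (-1) ^+ (letter w E && (flipped a o E (+) disagree ch a b E)).
Proof.
move=> pE; have uE := numbering_uniq ch a; rewrite (perm_uniq pE) /= in uE.
case/andP: uE => PE uE.
pose g C t : R := (-1) ^+ (t && flipped a o C) *
  (if C == P then Phi_if R n t x else Phi_if R (disagree ch a b C) t (letter w C)).
transitivity (\sum_(v : word ch a) \prod_(C <- num a) g C (letter v C)).
  apply: eq_bigr => v _; rewrite big_split /=; congr (_ * _).
  rewrite (perm_big _ pE) big_cons eqxx; congr (_ * _); apply: eq_big_seq => E EE.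
  by rewrite ifN //; apply: contraNneq PE => <-.
rewrite sum_word (perm_big _ pE) big_cons; congr (_ * _).
  by rewrite /g eqxx /= mul1r Phi_if_color.
apply: eq_big_seq => E EE; have /negPf EP : E != P by apply: contraNneq PE => <-.
by rewrite /g EP /= mul1r Phi_if_color.
Qed.

Lemma sum_rest_pair a b o r (w : word ch b) P Q n m x y :
  perm_eq (num a) [:: P, Q & uninvolved a r] ->
  \sum_(v : word ch a) color_coef o v
     * (Phi_if R n (letter v P) x * Phi_if R m (letter v Q) y * rest_coef r v w)
  = (-1) ^+ (x && (flipped a o P (+) n)) * (-1) ^+ (y && (flipped a o Q (+) m))
    * \prod_(E <- uninvolved a r)
        (-1) ^+ (letter w E && (flipped a o E (+) disagree ch a b E)).
Proof.
move=> pE; have uE := numbering_uniq ch a; rewrite (perm_uniq pE) /= in uE.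
case/and3P: uE; rewrite inE negb_or => /andP[PQ PE] QE uE.
pose g C t : R := (-1) ^+ (t && flipped a o C) *
  (if C == P then Phi_if R n t x else if C == Q then Phi_if R m t y
   else Phi_if R (disagree ch a b C) t (letter w C)).
have gE C t : C \in uninvolved a r -> g C t =
    (-1) ^+ (t && flipped a o C) * Phi_if R (disagree ch a b C) t (letter w C).
  move=> CE; have CP : C != P by apply: contraNneq PE => <-.
  have CQ : C != Q by apply: contraNneq QE => <-.
  by rewrite /g (negPf CP) (negPf CQ).
have QP : Q != P by rewrite eq_sym.
transitivity (\sum_(v : word ch a) \prod_(C <- num a) g C (letter v C)).
  apply: eq_bigr => v _; rewrite /color_coef !(perm_big _ pE) !big_cons.
  rewrite /= /g !eqxx (negPf QP) [X in _ = _ * (_ * X)](eq_big_seq _ (fun E EE => gE E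
    _ EE)).
  by rewrite big_split /= -[_ * _ * rest_coef _ _ _]mulrA mulrACA [X in _ * X = _]mulrACA.
rewrite sum_word (perm_big _ pE) !big_cons /= mulrA; congr (_ * _ * _).
- by rewrite /g eqxx /= mul1r Phi_if_color.
- by rewrite /g (negPf QP) eqxx /= mul1r Phi_if_color.
by apply: eq_big_seq => E EE; rewrite !gE //= mul1r Phi_if_color.
Qed.

Lemma m_color (n t e f : bool) :
  \sum_x \sum_y \sum_z
    m_coef R x y z * Phi_if R n z t * ((-1) ^+ (x && e) * (-1) ^+ (y && f))
  = if e == f then 2%:R * (-1) ^+ (t && (e (+) n)) else 0.
Proof.
by rewrite !big_bool; case: n t e f => [] [] [] []; rewrite /Phi_if /=; ring.
Qed.

(** The sign [(-1) ^+ e] reflects that Delta sends 1 + X to its tensor square, but 1 - X to minus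
    its tensor square. *)
Lemma Delta_color (n m t u e : bool) :
  \sum_x \sum_y \sum_z
    Delta_coef R x y z * Phi_if R n y t * Phi_if R m z u * (-1) ^+ (x && e)
  = (-1) ^+ e * ((-1) ^+ (t && (e (+) n)) * (-1) ^+ (u && (e (+) m))).
Proof.
by rewrite !big_bool; case: n m t u e => [] [] [] [] []; rewrite /Phi_if /=; ring.
Qed.

Lemma sum_triple (V : finType) (S : R) (c u : V -> R) (K : bool -> bool -> bool -> V ->
  R) :
  \sum_v c v * (S * (\sum_x \sum_y \sum_z K x y z v) * u v)
  = S * \sum_x \sum_y \sum_z \sum_v c v * (K x y z v * u v).
Proof.
rewrite mulr_sumr.
under eq_bigr => v _.
  rewrite -mulrA mulrCA mulr_suml !mulr_sumr.
  under eq_bigr => x _.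
    rewrite mulr_suml !mulr_sumr.
    under eq_bigr => y _ do rewrite mulr_suml !mulr_sumr.
    over.
  over.
rewrite exchange_big; apply: eq_bigr => x _; rewrite mulr_sumr.
rewrite exchange_big; apply: eq_bigr => y _; rewrite mulr_sumr.
by rewrite exchange_big; apply: eq_bigr => z _; rewrite mulr_sumr.
Qed.

End Coefficients.

(** * The action of one saddle on one colouring *)

Section Saddle.
Variables (a : vertex D) (r : crossing D) (o : {ffun ldart D -> bool}).
Hypotheses (ar : ~~ a r) (co : coherent a o).
Local Notation b := (toggle a r).

Lemma cdart_xy c i : vcircle c (cdart r i) =
  if (i == bot_left) || (i == if c r then bot_right else top_left)
  then xcircle c r else ycircle c r.
Proof.
have e j k : resolve c (cdart r j) = cdart r k ->
    vcircle c (cdart r j) = vcircle c (cdart r k).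
  by move=> <-; rewrite vcircle_resolve.
rewrite /xcircle /ycircle.
case cr: (c r) (resolve_cdart c r) => -[[[/e e1 /e e2] /e e3] /e e4];
  by case: (ord4P i) => ->; rewrite ?eqxx ?ord4_neq /=.
Qed.

Lemma involved_xy c C : C \in vcircles c ->
  involved r C = (C == xcircle c r) || (C == ycircle c r).
Proof.
move=> Cc; apply/existsP/orP => [[i iC]|[]/eqP->].
- rewrite -(vcircle_id Cc iC) cdart_xy.
  by case: ifP => _; [left | right].
- by exists bot_left; apply: mem_vcircle.
by exists top_right; apply: mem_vcircle.
Qed.

Lemma alternatingE c (p : {ffun ldart D -> bool}) : coherent c p ->
  alternating p r = (p (cdart r bot_left) == p (cdart r top_right)).
Proof.
move=> coc; have := coherent_resolve (cdart r bot_left) coc.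
have := coherent_resolve (cdart r top_right) coc; rewrite !resolve_cdart /alternating.
by case: (c r) => -> ->; do 2!case: (p _).
Qed.

(** The standard orientation alternates too, so an alternating [o] agrees with it at all four darts
    or at none. *)
Lemma std_alternating i : alternating o r ->
  (o (cdart r i) != std_out i) = ~~ o (cdart r bot_left).
Proof.
case/and3P => /eqP o1 /eqP o2 o3; move: o1 o2 o3; rewrite /std_out.
by case: (ord4P i) => ->; rewrite ?eqxx ?ord4_neq /=; do 4?case: (o _).
Qed.

Lemma exit_circle_0 x : exit_circle o a r x = if x then xcircle a r else ycircle a r.
Proof.
rewrite /exit_circle /exit_dart cdart_xy (negPf ar).
by case: x; case: (o _); rewrite ?eqxx ?ord4_neq.
Qed.

(** In the 1-resolution the exit dart labelled [true] lies on the marked bottom string only if [o]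
    leaves through [bot_left]; in the 0-resolution it always lies on the marked string. *)
Lemma exit_circle_1 x :
  exit_circle o b r x = if x == o (cdart r bot_left) then xcircle b r else ycircle b r.
Proof.
rewrite /exit_circle /exit_dart cdart_xy ffunE eqxx (negPf ar) /=.
by case: x; case: (o _); rewrite ?eqxx ?ord4_neq.
Qed.

Lemma xcircle_in c : xcircle c r \in vcircles c.
Proof. exact: vcircle_in. Qed.

Lemma ycircle_in c : ycircle c r \in vcircles c.
Proof. exact: vcircle_in. Qed.

Lemma separated_0 : separated o a r = (xcircle a r != ycircle a r).
Proof. by rewrite /separated !exit_circle_0. Qed.

Lemma separated_1 : separated o b r = (xcircle b r != ycircle b r).
Proof. by rewrite /separated !exit_circle_1; case: (o _); rewrite // eq_sym. Qed.

Lemma nonstd_alternating c C : alternating o r -> coherent c o -> C \in vcircles c ->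
  (exists j, cdart r j \in C) -> flipped c o C (+) nonstd ch c r C = ~~ o (cdart r
    bot_left).
Proof.
move=> alt coc Cc [j jC]; apply: (nonstdE coc Cc jC) => i _.
exact: std_alternating.
Qed.

Lemma flipped_nonstd c C : alternating o r -> coherent c o -> C \in vcircles c ->
  (exists j, cdart r j \in C) -> ~~ o (cdart r bot_left) (+) nonstd ch c r C = flipped
    c o C.
Proof.
by move=> alt coc Cc jC; rewrite -(nonstd_alternating alt coc Cc jC) -addbA addbb addbF.
Qed.

Lemma xcircle_dart c : exists j, cdart r j \in xcircle c r.
Proof. by exists bot_left; apply: mem_vcircle. Qed.

Lemma ycircle_dart c : exists j, cdart r j \in ycircle c r.
Proof. by exists top_right; apply: mem_vcircle. Qed.

Lemma uninvolved_flipped E : alternating o r -> E \in uninvolved a r ->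
  flipped a o E (+) disagree ch a b E = flipped b o E.
Proof.
move=> alt EE; have cob := coherent_toggle co alt.
apply: disagreeE => //; first by move: EE; rewrite mem_uninvolved => /andP[].
by move: EE; rewrite -(uninvolved_toggle _ alt) mem_uninvolved => /andP[].
Qed.

Variable R : comPzRingType.
Notation color_coef := (color_coef R).
Notation edge_coef := (edge_coef R).

Lemma saddle_merge (w : word ch b) : xcircle a r != ycircle a r ->
  \sum_(v : word ch a) color_coef o v * saddle_coef R r v w
  = if alternating o r then edge_coef o a r * color_coef o w else 0.
Proof.
move=> XY; rewrite /saddle_coef XY /=.
set S := _ * sgn R _ _; set nX := nonstd _ a r (xcircle a r).
set nY := nonstd _ a r (ycircle a r); set n := nonstd _ b r _.
have pa : perm_eq (num a) [:: xcircle a r, ycircle a r & uninvolved a r].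
  by apply: numbering_pair; rewrite ?xcircle_in ?ycircle_in // => C; apply: involved_xy.
have YX : ycircle a r != xcircle a r by rewrite eq_sym.
have eX : flipped a o (xcircle a r) (+) nX = ~~ o (cdart r bot_left).
  apply: (nonstdE co (xcircle_in a) (mem_vcircle _ _)) => i.
  rewrite -vcircle_eq -/(xcircle a r) cdart_xy (negPf ar) /std_out.
  have := coherent_resolve (cdart r bot_left) co; rewrite resolve_cdart (negPf ar).
  by case: (ord4P i) => ->; rewrite ?eqxx ?ord4_neq /= ?(negPf YX) //;
    do 2!case: (o _).
have eY : flipped a o (ycircle a r) (+) nY = ~~ o (cdart r top_right).
  apply: (nonstdE co (ycircle_in a) (mem_vcircle _ _)) => i.
  rewrite -vcircle_eq -/(ycircle a r) cdart_xy (negPf ar) /std_out.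
  have := coherent_resolve (cdart r top_right) co; rewrite resolve_cdart (negPf ar).
  by case: (ord4P i) => ->; rewrite ?eqxx ?ord4_neq /= ?(negPf XY) //;
    do 2!case: (o _).
rewrite sum_triple.
transitivity (S * ((\sum_x \sum_y \sum_z m_coef R x y z * Phi_if R n z (letter w
  (xcircle b r))
      * ((-1) ^+ (x && ~~ o (cdart r bot_left)) * (-1) ^+ (y && ~~ o (cdart r
        top_right))))
   * \prod_(E <- uninvolved a r)
        (-1) ^+ (letter w E && (flipped a o E (+) disagree ch a b E)))).
  congr (_ * _); rewrite mulr_suml; apply: eq_bigr => x _.
  rewrite mulr_suml; apply: eq_bigr => y _; rewrite mulr_suml; apply: eq_bigr => z _.
  rewrite -mulrA -eX -eY -(sum_rest_pair _ o w _ _ _ _ pa) mulr_sumr.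
  apply: eq_bigr => v _; move: (color_coef o v) => c.
  rewrite -/(rest_coef R r v w); move: (rest_coef R r v w) => u.
  move: (m_coef _ _ _ _) => m.
  by do 3!(move: (Phi_if _ _ _ _) => ?); ring.
(* Relative to the standard orientation the upper colours are read off at [bot_left] and
   [top_right]. They agree exactly when [o] alternates; otherwise (1 + X)(1 - X) = 0. *)
rewrite m_color (inj_eq negb_inj) (alternatingE co).
case: ifP; last by rewrite mul0r mulr0.
rewrite -(alternatingE co) => alt; have cob := coherent_toggle co alt.
have sepa : separated o a r by rewrite separated_0.
have sepb : ~~ separated o b r by rewrite separated_toggle // sepa.
have /negPn/eqP XY' : ~~ (xcircle b r != ycircle b r) by rewrite -separated_1.
have pb : perm_eq (num b) (xcircle b r :: uninvolved a r).
  rewrite -(uninvolved_toggle _ alt); apply: numbering_single; first exact: xcircle_in.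
  by move=> C /involved_xy->; rewrite -XY' orbb.
rewrite /edge_coef sepa expr1 /S /sgn -signr_addb.
have -> : edge_odd ch o a r true = odd_perm (comparison (num a) [:: xcircle a r,
  ycircle a r & uninvolved a r])
    (+) odd_perm (comparison (num b) (xcircle b r :: uninvolved a r)).
  by rewrite /edge_odd sepa /merge_odd !exit_circle_0 exit_circle_1 XY' if_same.
rewrite -!mulrA; congr (_ * (_ * _)); rewrite /color_coef (perm_big _ pb) big_cons /=.
rewrite (flipped_nonstd alt cob (xcircle_in b) (xcircle_dart b)); congr (_ * _).
by apply: eq_big_seq => E EE; rewrite uninvolved_flipped.
Qed.

(* The standard orientation of the two lower v-circles of a splitting restricts
   to one of the two orientations of the upper v-circle. *)
Lemma split_alternating :
  xcircle a r = ycircle a r -> xcircle b r != ycircle b r -> alternating o r.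
Proof.
move=> XY XY'.
pose o' : {ffun ldart D -> bool} := [ffun d => orient ch b d (+)
  (if d \in xcircle b r then ~~ orient ch b (cdart r bot_left)
   else (d \in ycircle b r) && ~~ orient ch b (cdart r top_right))].
have cob : coherent b o'.
  apply/coherentP => d; rewrite !ffunE orient_glue orient_resolve.
  by rewrite -!vcircle_eq vcircle_glue vcircle_resolve !addNb.
have o'bl : o' (cdart r bot_left) by rewrite ffunE mem_vcircle addbN addbb.
have o'tr : o' (cdart r top_right).
  rewrite ffunE -vcircle_eq eq_sym (negPf XY') mem_vcircle /=.
  by rewrite addbN addbb.
have alt' : alternating o' r by rewrite (alternatingE cob) o'bl o'tr.
have coa : coherent a o' by rewrite -(toggleK r a); apply: coherent_toggle.
have tr_in : cdart r top_right \in vcircle a (cdart r bot_left).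
  by rewrite -vcircle_eq eq_sym; apply/eqP.
rewrite (alternatingE co); have := coherent_addb co coa tr_in.
by rewrite o'bl o'tr !addbT => /negb_inj->.
Qed.

Lemma saddle_split (w : word ch b) : xcircle a r = ycircle a r ->
  \sum_(v : word ch a) color_coef o v * saddle_coef R r v w
  = if alternating o r then edge_coef o a r * color_coef o w else 0.
Proof.
move=> XY; rewrite /saddle_coef XY eqxx /=.
case: (boolP (xcircle b r != ycircle b r)) => [XY'|/negPn/eqP XY'] /=; last first.
  (* The non-orientable saddle: its map is 0, and an alternating [o] would change the number of
     v-circles. *)
  rewrite big1 => [|v _]; last by rewrite /theta_coef mul0r mulr0.
  case: ifP => // alt; have := separated_toggle co alt.
  by rewrite separated_0 separated_1 XY XY' !eqxx.
have alt := split_alternating XY XY'; rewrite alt -XY.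
have cob := coherent_toggle co alt.
set S := _ * sgn R _ _; set n := nonstd _ a r _.
set nX := nonstd _ b r (xcircle b r); set nY := nonstd _ b r (ycircle b r).
have pa : perm_eq (num a) (xcircle a r :: uninvolved a r).
  apply: numbering_single; first exact: xcircle_in.
  by move=> C /involved_xy->; rewrite -XY orbb.
have eX : flipped a o (xcircle a r) (+) n = ~~ o (cdart r bot_left).
  exact: nonstd_alternating alt co (xcircle_in a) (xcircle_dart a).
rewrite sum_triple.
transitivity (S * ((\sum_x \sum_y \sum_z Delta_coef R x y z
      * Phi_if R nX y (letter w (xcircle b r)) * Phi_if R nY z (letter w (ycircle b r))
      * (-1) ^+ (x && ~~ o (cdart r bot_left)))
   * \prod_(E <- uninvolved a r)
        (-1) ^+ (letter w E && (flipped a o E (+) disagree ch a b E)))).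
  congr (_ * _); rewrite mulr_suml; apply: eq_bigr => x _.
  rewrite mulr_suml; apply: eq_bigr => y _; rewrite mulr_suml; apply: eq_bigr => z _.
  rewrite -mulrA -eX -(sum_rest_single _ o w _ _ pa) mulr_sumr.
  apply: eq_bigr => v _; move: (color_coef o v) => c.
  rewrite -/(rest_coef R r v w); move: (rest_coef R r v w) => u.
  move: (Delta_coef _ _ _ _) => m.
  by do 3!(move: (Phi_if _ _ _ _) => ?); ring.
rewrite Delta_color.
have sepa : separated o a r = false by rewrite separated_0 XY eqxx.
have sepb : separated o b r by rewrite separated_toggle // sepa.
have pb : perm_eq (num b) [:: xcircle b r, ycircle b r & uninvolved a r].
  rewrite -(uninvolved_toggle _ alt).
  by apply: numbering_pair; rewrite ?xcircle_in ?ycircle_in // => C; apply: involved_xy.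
(* When [o] does not leave through [bot_left], Delta acts on 1 - X and yields a sign, while
   [edge_odd] lists the lower v-circles against the x-marker and yields a second one. *)
have -> : edge_coef o a r = S * (-1) ^+ (~~ o (cdart r bot_left)).
  rewrite /edge_coef sepa mulr1 /S /sgn -!signr_addb; congr (_ ^+ _).
  rewrite -/(cmp_odd _ _) -/(cmp_odd (num b) _) /edge_odd sepa /= !exit_circle_1
    exit_circle_0.
  have cE : merge_odd (num b) (num a) (xcircle b r) (ycircle b r) (xcircle a r)
    (uninvolved a r)
     = cmp_odd (num a) (xcircle a r :: uninvolved a r)
       (+) cmp_odd (num b) [:: xcircle b r, ycircle b r & uninvolved a r].
    by rewrite /merge_odd addbC.
  case: (o _); rewrite /= ?addbT ?addbF; first by rewrite cE.
  by rewrite merge_oddC ?numbering_uniq // cE.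
rewrite -!mulrA; congr (_ * (_ * _)); rewrite /color_coef (perm_big _ pb) !big_cons /=.
rewrite (flipped_nonstd alt cob (xcircle_in b) (xcircle_dart b)).
rewrite (flipped_nonstd alt cob (ycircle_in b) (ycircle_dart b)).
congr (_ * (_ * (_ * _))).
by apply: eq_big_seq => E EE; rewrite uninvolved_flipped.
Qed.

Lemma saddle_color (w : word ch b) :
  \sum_(v : word ch a) color_coef o v * saddle_coef R r v w
  = if alternating o r then edge_coef o a r * color_coef o w else 0.
Proof.
case: (eqVneq (xcircle a r) (ycircle a r)) => [XY|XY]; first exact: saddle_split.
exact: saddle_merge.
Qed.

End Saddle.
End ColorBasis.

(** * Sectors *)

Section Sectors.
Variables (D : vlink) (ch : choices D) (R : comPzRingType).
Implicit Types (a b : vertex D) (r s : crossing D) (d e : ldart D) (C : {set ldart D}).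
Implicit Types o : {ffun ldart D -> bool}.

Local Notation num := (numbering ch).
Local Notation color_coef := (color_coef R).
Local Notation edge_coef := (edge_coef ch R).
Local Notation flipped := (flipped ch).

Lemma prod_add_sign (s : seq {set ldart D}) (g : {set ldart D} -> bool) :
  \prod_(C <- s) (1 + (-1) ^+ g C) = if has g s then 0 else 2%:R ^+ size s :> R.
Proof.
elim: s => [|C s IH]; first by rewrite big_nil.
rewrite big_cons IH /=; case: (g C) => /=; first by rewrite expr1 subrr mul0r.
by case: (has g s); rewrite ?mulr0 // exprS.
Qed.

Definition color_word a o : word ch a :=
  [tuple flipped a o (nth set0 (num a) i) | i < size (num a)].

Lemma letter_color_word a o C : C \in num a -> letter (color_word a o) C = flipped a o C.
Proof.
move=> Ca; have ltC : (index C (num a) < size (num a))%N by rewrite index_mem.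
rewrite /letter (_ : index C (num a) = Ordinal ltC) // -tnth_nth tnth_mktuple /=.
by rewrite nth_index.
Qed.

(** Inverse of [color_word] on coherent orientations: the chosen orientation, reversed on the
    v-circles with letter X. *)
Definition word_orientation a (u : word ch a) : {ffun ldart D -> bool} :=
  [ffun d => orient ch a d (+) letter u (vcircle a d)].

Lemma coherent_word_orientation a (u : word ch a) : coherent a (word_orientation u).
Proof.
apply/coherentP => d; rewrite !ffunE vcircle_glue vcircle_resolve.
by rewrite orient_glue orient_resolve !addNb.
Qed.

Lemma flipped_vcircle a o d : coherent a o -> flipped a o (vcircle a d) = o d (+)
  orient ch a d.
Proof. by move=> co; rewrite (flippedE ch co (vcircle_in a d) (mem_vcircle a d)). Qed.

Lemma color_word_orientationK a o :
  (word_orientation (color_word a o) == o) = coherent a o.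
Proof.
apply/eqP/idP => [<-|co]; first exact: coherent_word_orientation.
apply/ffunP => d; rewrite ffunE letter_color_word ?mem_numbering ?vcircle_in //.
by rewrite flipped_vcircle // addbC -addbA addbb addbF.
Qed.

Lemma word_orientationK a (u : word ch a) : color_word a (word_orientation u) = u.
Proof.
apply: eq_from_tnth => i; rewrite tnth_mktuple.
have Ci : nth set0 (num a) i \in num a by rewrite mem_nth.
move: (Ci); rewrite mem_numbering => /vcirclesP[d Cd].
rewrite Cd (flipped_vcircle _ (coherent_word_orientation u)) ffunE addbC addbA addbb.
by rewrite -Cd /letter index_uniq ?numbering_uniq // (tnth_nth false).
Qed.

(** The colours are the characters of the elementary 2-group of words, and this is their
    orthogonality; the norm is the source of the powers of 2 in the coordinates. *)
Lemma color_coef_orth a o o' : coherent a o -> coherent a o' ->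
  \sum_(v : word ch a) color_coef o v * color_coef o' v
  = if o == o' then 2%:R ^+ size (num a) else 0.
Proof.
move=> co co'.
transitivity (\sum_(v : word ch a) \prod_(C <- num a)
    (-1) ^+ (letter v C && (flipped a o C (+) flipped a o' C)) : R).
  apply: eq_bigr => v _; rewrite -big_split; apply: eq_bigr => C _ /=.
  by rewrite -signr_addb andb_addr.
rewrite (@sum_word _ _ _ _ (fun C t => (-1) ^+ (t && (flipped a o C (+) flipped a o'
  C)))).
rewrite prod_add_sign; case: eqP => [->|ne].
  by rewrite ifF //; apply/hasP => -[C _]; rewrite addbb.
rewrite ifT //; apply/hasP; apply: contrapT => H; apply: ne; apply/ffunP => d.
apply/eqP/negPn/negP => od; apply: H; exists (vcircle a d).
  by rewrite mem_numbering vcircle_in.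
by rewrite !flipped_vcircle //; move: od; do 2!case: (_ d); case: orient.
Qed.

(** The dual orthogonality relation, with coherent orientations indexed by their colour words. *)
Lemma color_coef_complete a (v w : word ch a) :
  \sum_(o | coherent a o) color_coef o v * color_coef o w
  = if v == w then 2%:R ^+ size (num a) else 0.
Proof.
pose G (u : word ch a) : R := \prod_(C <- num a) (-1) ^+ (letter u C && (letter v C (+)
  letter w C)).
transitivity (\sum_(u : word ch a) G u).
  rewrite (reindex_onto (color_word a) (@word_orientation a)) => [|u _];
    last exact: word_orientationK.
  apply: eq_big => o; first by rewrite color_word_orientationK.
  move=> _; rewrite -big_split; apply: eq_big_seq => C Ca /=.
  by rewrite -signr_addb letter_color_word // andb_addr ![_ && letter _ _]andbC.
rewrite (@sum_word _ _ _ _ (fun C t => (-1) ^+ (t && (letter v C (+) letter w C)))).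
rewrite prod_add_sign; case: eqP => [->|ne].
  by rewrite ifF //; apply/hasP => -[C _]; rewrite addbb.
rewrite ifT //; apply/hasP; apply: contrapT => H; apply: ne; apply: eq_from_tnth => i.
apply/eqP/negPn/negP => vw; apply: H; exists (nth set0 (num a) i);
  first by rewrite mem_nth.
rewrite /letter !index_uniq ?numbering_uniq //; move: vw.
by rewrite !(tnth_nth false); do 2!case: nth.
Qed.

Implicit Types (X : generator ch -> R) (S : vertex D -> {ffun ldart D -> bool} -> R).

Definition boundary X (h : generator ch) : R := \sum_g X g * d_coef R g h.

Definition comb S (g : generator ch) : R :=
  \sum_(o | coherent (tag g) o) S (tag g) o * color_coef o (tagged g).

(** A pairing with the colour, equal to the coefficient of that colour times [2 ^+ size (num a)] and
    hence defined without division. *)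
Definition color_coord X a o : R :=
  \sum_(v : word ch a) X (Tagged (word ch) v) * color_coef o v.

Definition sector_boundary S b o : R :=
  \sum_(r | b r && alternating o r) edge_coef o (toggle b r) r * S (toggle b r) o.

Lemma sum_generator (F : generator ch -> R) :
  \sum_g F g = \sum_a \sum_(v : word ch a) F (Tagged (word ch) v).
Proof.
rewrite (sig_big_dep xpredT (fun _ => xpredT) (fun a v => F (Tagged (word ch) v))) /=.
by apply: eq_bigr => -[].
Qed.

Lemma saddle_color_eq a b r o (w : word ch b) :
  ~~ a r -> coherent a o -> b = toggle a r ->
  \sum_(v : word ch a) color_coef o v * saddle_coef R r v w
  = if alternating o r then edge_coef o a r * color_coef o w else 0.
Proof. by move=> ar co eb; move: w; rewrite eb => w; apply: saddle_color. Qed.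

Lemma boundary_comb S : boundary (comb S) = comb (sector_boundary S).
Proof.
apply: funext => -[b w]; rewrite /boundary sum_generator /comb /=.
transitivity (\sum_a \sum_(o | coherent a o) \sum_(r | [&& alternating o r, ~~ a r & b
  == toggle a r])
    S a o * (edge_coef o a r * color_coef o w)).
  apply: eq_bigr => a _.
  under eq_bigr => v _ do rewrite mulr_suml.
  rewrite exchange_big /=; apply: eq_bigr => o co.
  under eq_bigr => v _ do rewrite -mulrA.
  rewrite -!mulr_sumr; congr (_ * _); rewrite /d_coef /=.
  under eq_bigr => v _ do rewrite mulr_sumr.
  rewrite exchange_big /= [RHS]big_mkcond [LHS]big_mkcond /=; apply: eq_bigr => r _.
  case: (boolP (a r)) => ar; rewrite ?andbF //= toggle_flip //.
  by case: eqP => [e|]; rewrite ?andbF ?andbT // saddle_color_eq.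
rewrite (exchange_big_dep xpredT) //= [RHS]big_mkcond; apply: eq_bigr => o _ /=.
rewrite (exchange_big_dep (alternating o)) /=; last by move=> a r _ /and3P[].
rewrite [RHS](_ : _ = \sum_(r | alternating o r) if coherent b o && b r then
   S (toggle b r) o * (edge_coef o (toggle b r) r * color_coef o w) else 0); last first.
  case: (coherent b o) => /=; last by rewrite big1.
  rewrite /sector_boundary mulr_suml [RHS]big_mkcond [LHS]big_mkcond /=.
  apply: eq_bigr => r _; case: (b r); case: alternating => //=.
  by rewrite mulrCA mulrA.
apply: eq_bigr => r alt; rewrite alt /=.
have aE a : (coherent a o && (~~ a r && (b == toggle a r)))
    = ((coherent b o && b r) && (a == toggle b r)).
  apply/idP/idP => [/and3P[co ar /eqP->]|/andP[/andP[co br] /eqP->]].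
    by rewrite coherent_toggle // ffunE eqxx (negPf ar) toggleK eqxx.
  by rewrite coherent_toggle // ffunE eqxx br toggleK eqxx.
rewrite (eq_bigl _ _ aE); case: (coherent b o && b r); last by rewrite big_pred0.
by rewrite big_pred1_eq.
Qed.

Lemma color_coord_comb S b o : coherent b o ->
  color_coord (comb S) b o = S b o * 2%:R ^+ size (num b).
Proof.
move=> co; rewrite /color_coord /comb /=.
under eq_bigr => v _ do rewrite mulr_suml.
rewrite exchange_big /= (bigD1 o) //= -[RHS]addr0; congr (_ + _).
  under eq_bigr => v _ do rewrite -mulrA.
  by rewrite -mulr_sumr color_coef_orth // eqxx.
apply: big1 => o' /andP[co' ne]; under eq_bigr => v _ do rewrite -mulrA.
by rewrite -mulr_sumr color_coef_orth // (negPf ne) mulr0.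
Qed.

(** A crude bound for the number of v-circles, valid for all resolutions, so that one power of 2
    serves every corner. *)
Definition depth : nat := #|{set ldart D}|.

Lemma size_numbering_le a : (size (num a) <= depth)%N.
Proof.
by rewrite (perm_size (numbering_perm ch a)) -cardE; apply: max_card.
Qed.

Definition scaled_coord X a o : R := 2%:R ^+ (depth - size (num a)) * color_coord X a o.

Lemma comb_scaled_coord X g : comb (scaled_coord X) g = 2%:R ^+ depth * X g.
Proof.
case: g => a w; rewrite /comb /scaled_coord /color_coord /=.
under eq_bigr => o _ do rewrite -mulrA mulr_suml.
rewrite -mulr_sumr exchange_big /= (bigD1 w) //= [X in _ + X]big1 ?addr0 => [|v ne].
  under eq_bigr => o _ do rewrite -mulrA.
  rewrite -mulr_sumr color_coef_complete eqxx mulrCA mulrC -exprD.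
  by rewrite subnK ?size_numbering_le // mulrC.
under eq_bigr => o _ do rewrite -mulrA.
by rewrite -mulr_sumr color_coef_complete (negPf ne) mulr0.
Qed.

Lemma boundaryZ (c : R) X h : boundary (fun g => c * X g) h = c * boundary X h.
Proof. by rewrite /boundary mulr_sumr; apply: eq_bigr => g _; rewrite mulrA. Qed.

Lemma color_coordZ (c : R) X a o : color_coord (fun g => c * X g) a o = c * color_coord
  X a o.
Proof. by rewrite /color_coord mulr_sumr; apply: eq_bigr => g _; rewrite mulrA. Qed.

Lemma color_coord_boundary X b o : coherent b o ->
  2%:R ^+ depth * color_coord (boundary X) b o
  = sector_boundary (scaled_coord X) b o * 2%:R ^+ size (num b).
Proof.
move=> co; rewrite -color_coord_comb // -boundary_comb -color_coordZ;
  congr (color_coord _ _ _).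
by apply: funext => h; rewrite -boundaryZ; congr (boundary _ _); apply: funext => g;
  rewrite comb_scaled_coord.
Qed.

Definition isolated o : bool := [forall r, ~~ alternating o r].

Section Regular.
Hypothesis reg2 : forall x : R, 2%:R * x = 0 -> x = 0.

Lemma reg2X n (x : R) : 2%:R ^+ n * x = 0 -> x = 0.
Proof. by elim: n => [|n IH]; rewrite ?expr0 ?mul1r // exprS -mulrA => /reg2/IH. Qed.

Lemma color_coord_boundary_isolated X b o : coherent b o -> isolated o ->
  color_coord (boundary X) b o = 0.
Proof.
move=> co /forallP iso; apply: (@reg2X depth); rewrite color_coord_boundary //.
rewrite /sector_boundary big_pred0 ?mul0r // => r.
by rewrite (negPf (iso r)) andbF.
Qed.

Lemma sector_boundary_cycle X b o : coherent b o -> (forall h, boundary X h = 0) ->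
  sector_boundary (scaled_coord X) b o = 0.
Proof.
move=> co dX; apply: (@reg2X (size (num b))); rewrite mulrC -color_coord_boundary //.
rewrite /color_coord big1 ?mulr0 // => v _.
by rewrite dX mul0r.
Qed.

(** This is 2 divided by [edge_coef]: the same sign and the complementary power of 2. *)
Definition homotopy_coef o a r : R :=
  (-1) ^+ edge_odd ch o a r true * 2%:R ^+ (~~ separated o a r).

Lemma edge_homotopy_coef o a r : edge_coef o a r * homotopy_coef o a r = 2%:R.
Proof.
rewrite /homotopy_coef !edge_coefE mulrACA -signr_addb addbb mul1r -exprD.
by case: separated.
Qed.

(** The sign is [face_oddP]; the powers of 2 agree by [separated_face]. *)
Lemma edge_homotopyC o a r s : r != s -> coherent a o -> alternating o r -> alternating
  o s ->
  edge_coef o a r * homotopy_coef o a s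
  = - (homotopy_coef o (toggle a r) s * edge_coef o (toggle a s) r).
Proof.
move=> rs co altr alts; rewrite /homotopy_coef !edge_coefE [LHS]mulrACA [X in _ = -
  X]mulrACA -!signr_addb -!exprD.
have := face_oddP ch true true rs co altr alts; have := separated_face ch co altr alts.
rewrite /face_odd; move: (edge_odd _ _ a r _) (edge_odd _ _ a s _) => e1 e2.
move: (edge_odd _ _ _ s _) (edge_odd _ _ _ r _) => e3 e4 ne f.
have -> : (separated o a r + ~~ separated o a s = ~~ separated o (toggle a r) s +
  separated o (toggle a s) r)%N.
  by move: ne; do 4!case: separated.
rewrite -mulNr; congr (_ * _); move: f; case: e1 e2 e3 e4 => [] [] [] [] //= _;
 by rewrite ?expr1 ?expr0 ?opprK.
Qed.

(* Dividing the edges in the direction of an alternating crossing into 2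
   contracts twice the identity of the sector. *)
Lemma sector_contraction S r o b :
  (forall c, coherent c o -> sector_boundary S c o = 0) ->
  alternating o r -> coherent b o ->
  sector_boundary (fun a p => if a r then 0 else homotopy_coef p a r * S (toggle a r)
    p) b o
  = 2%:R * S b o.
Proof.
move=> dS alt co; rewrite /sector_boundary.
case: (boolP (b r)) => br.
  rewrite (bigD1 r) /= ?br // ffunE eqxx br /= toggleK mulrA edge_homotopy_coef.
  rewrite big1 ?addr0 // => s /andP[_ sr].
  by rewrite ffunE eq_sym (negPf sr) br mulr0.
(* With [b] at the 0-end of its edge, the cycle condition at [toggle b r] expresses twice [S b o]
   through the other edges arriving there, and anticommutation turns these into edges arriving at
   [b]. *)
have co' := coherent_toggle co alt; have := dS _ co'; rewrite /sector_boundary.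
rewrite (bigD1 r) /=; last by rewrite ffunE eqxx (negPf br) alt.
rewrite toggleK => /(congr1 (fun x => homotopy_coef o b r * x)).
rewrite mulr0 mulrDr mulrA (mulrC (homotopy_coef _ _ _)) edge_homotopy_coef.
move/eqP; rewrite addr_eq0 => /eqP->; rewrite mulr_sumr -sumrN.
apply: eq_big => [s|s /andP[bs alts]].
  rewrite ffunE; case: (eqVneq s r) => [->|_] /=; first by rewrite (negPf br) andbF.
  by rewrite andbT.
have rs : s != r by apply: contraNneq br => <-.
rewrite ffunE eq_sym (negPf rs) /= (negPf br) (toggleC b s r).
have := @edge_homotopyC o (toggle b s) s r rs (coherent_toggle co alts) alts alt.
by rewrite toggleK mulrA => ->; rewrite mulNr mulrA (toggleC b s r).
Qed.

Lemma boundary_of_cycle X : (forall h, boundary X h = 0) ->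
  (forall a o, coherent a o -> isolated o -> color_coord X a o = 0) ->
  exists Y, forall h, boundary Y h = 2%:R ^+ depth.+1 * X h.
Proof.
move=> dX X_iso.
(* The crossing is picked for each [o] independently of the corner, so each sector is contracted
   along a single direction. In the exponent, [depth] pays for passing to colours and 1 for the
   contraction. *)
pose S a o : R := if [pick r | alternating o r] is Some r then
  if a r then 0 else homotopy_coef o a r * scaled_coord X (toggle a r) o else 0.
exists (comb S) => h; rewrite boundary_comb exprS -mulrA -comb_scaled_coord mulr_sumr.
apply: eq_bigr => o co; rewrite mulrA; congr (_ * _).
rewrite /sector_boundary /S; case: pickP => [r alt|iso].
  by apply: sector_contraction => // c coc; apply: sector_boundary_cycle.
have iso_o : isolated o by apply/forallP => r; rewrite iso.
rewrite /scaled_coord X_iso // !mulr0 big_pred0 // => r.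
by rewrite iso andbF.
Qed.

Definition sector_vector a o : generator ch -> R :=
  comb (fun b p => ((b == a) && (p == o))%:R).

Lemma boundary_sector_vector a o h : isolated o -> boundary (sector_vector a o) h = 0.
Proof.
move=> /forallP iso; rewrite boundary_comb /comb big1 // => p _.
rewrite /sector_boundary big1 ?mul0r // => r /andP[_ alt].
by case: (eqVneq p o) alt => [->|_]; rewrite ?(negPf (iso r)) // andbF mulr0.
Qed.

Lemma color_coord_sector_vector a o b p : coherent b p ->
  color_coord (sector_vector a o) b p = ((b == a) && (p == o))%:R * 2%:R ^+ size (num b).
Proof. exact: color_coord_comb. Qed.

End Regular.
End Sectors.

(** * Orientations of the link *)

Section LinkOrientations.
Variable D : vlink.
Implicit Types (a b : vertex D) (r s : crossing D) (d e : ldart D).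
Implicit Types o : {ffun ldart D -> bool}.

Definition link_orientations : {set {ffun ldart D -> bool}} :=
  [set o : {ffun ldart D -> bool} |
    [forall d, (o (glue d) == ~~ o d) && (o (straight d) == ~~ o d)]].

Lemma link_orientationsP o :
  reflect (forall d, o (glue d) = ~~ o d /\ o (straight d) = ~~ o d) (o \in
    link_orientations).
Proof.
rewrite inE; apply: (iffP forallP) => H d; last by case: (H d) => -> ->; rewrite !eqxx.
by case/andP: (H d) => /eqP-> /eqP->.
Qed.

Local Notation same_component := (generated (@glue D) (@straight _ _ _)).

Lemma same_component_sym : connect_sym same_component.
Proof. apply: sym_connect_sym; apply: generated_sym;
  [exact: glueK | exact: straightK]. Qed.

Lemma link_orientation_diff o d e : o \in link_orientations ->
  connect same_component d e -> o e (+) dir e = o d (+) dir d.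
Proof.
move/link_orientationsP => H /connectP[p]; elim: p d => [|x p IH] d /=;
  first by move=> _ ->.
case/andP => dx xp /(IH _ xp)->.
apply: (@generated_ind _ _ _ (fun y => o y (+) dir y = o d (+) dir d)) dx => // y <-.
  by rewrite (proj1 (H y)) dir_glue addbN addNb negbK.
by rewrite (proj2 (H y)) dir_straight addbN addNb negbK.
Qed.

Lemma card_link_orientations : #|link_orientations| = (2 ^ ncomponents D)%N.
Proof.
pose roots_set := [set d | d \in fingraph.roots same_component].
(* An orientation amounts to the set of components where it differs from [dir], each represented by
   its root dart. *)
pose signs (o : {ffun ldart D -> bool}) := [set d in roots_set | o d (+) dir d].
have eqr d e : connect same_component d e -> fingraph.root same_component d =
  fingraph.root same_component e.
  by move=> /(fingraph.rootP same_component_sym).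
have oE o d : o \in link_orientations ->
    o d = dir d (+) (fingraph.root same_component d \in signs o).
  move=> Lo; rewrite !inE roots_root; last exact: same_component_sym.
  rewrite (link_orientation_diff Lo (connect_root _ d)).
  by rewrite addbC -addbA addbb addbF.
rewrite -[RHS](_ : #|powerset roots_set| = _); last first.
  rewrite card_powerset /ncomponents /n_comp_mem; congr (2 ^ _)%N.
  by apply: eq_card => d; rewrite !inE andbT.
have inj : {in link_orientations &, injective signs}.
  by move=> o o' Lo Lo' E; apply/ffunP => d; rewrite !oE // E.
rewrite -(card_in_imset inj); apply: eq_card => A; rewrite powersetE.
apply/imsetP/subsetP => [[o Lo ->] d|sA]; first by rewrite !inE => /andP[].
exists [ffun d => dir d (+) (fingraph.root same_component d \in A)].
  apply/link_orientationsP => d; rewrite !ffunE dir_glue dir_straight.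
  rewrite -(eqr d (glue d)) ?addNb; last exact/connect1/generated_f.
  by rewrite -(eqr d (straight d)) ?addNb //; apply/connect1/generated_g.
apply/setP => d; rewrite !inE ffunE addbC addbA addbb addFb.
apply/idP/andP => [dA|[/eqP->//]].
have := sA _ dA; rewrite inE => rd; split=> //.
by have /eqP-> : fingraph.root same_component d == d by [].
Qed.

(** The oriented resolution: if the two left darts agree under [o], the left string of the
    0-resolution cannot follow [o]. *)
Definition seifert_state o : vertex D :=
  [ffun r => o (cdart r bot_left) == o (cdart r top_left)].

Lemma straight_cdart r :
  (straight (cdart r bot_left) = cdart r top_right)
  * (straight (cdart r bot_right) = cdart r top_left).
Proof. by rewrite /= !opp4E. Qed.

Lemma link_orientation_cdart o r : o \in link_orientations ->
  (o (cdart r top_right) = ~~ o (cdart r bot_left))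
  * (o (cdart r top_left) = ~~ o (cdart r bot_right)).
Proof.
move/link_orientationsP => H; rewrite -!(straight_cdart r).
by rewrite !(proj2 (H _)).
Qed.

Lemma coherent_seifert_state o : o \in link_orientations -> coherent (seifert_state o) o.
Proof.
move=> Lo; have := Lo => /link_orientationsP H; apply/coherentP => d; split;
  first by case: (H d).
case: d => [[[r i]|x]|x]; [|exact: (proj2 (H (inl (inr x))))|exact: (proj2 (H (inr x)))].
rewrite -/(cdart r i); case: (link_orientation_cdart r Lo) => E1 E2.
by case: (ord4P i) => ->; rewrite resolve_cdart ffunE; case: ifP; rewrite ?E1 ?E2;
  do 2!case: (o _).
Qed.

Lemma isolated_link_orientation o : o \in link_orientations -> isolated o.
Proof.
move=> Lo; apply/forallP => r; rewrite /alternating (link_orientation_cdart r Lo).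
by case: (o _).
Qed.

(** At a crossing where a coherent [o] does not alternate, opposite darts carry opposite values. So
    [o] also goes straight through, and it determines the resolution. *)
Lemma isolatedP a o : coherent a o -> isolated o ->
  o \in link_orientations /\ a = seifert_state o.
Proof.
move=> co /forallP iso.
have H r : (o (cdart r top_right) = ~~ o (cdart r bot_left))
  * (o (cdart r top_left) = ~~ o (cdart r bot_right))
  * (a r = (o (cdart r bot_left) == o (cdart r top_left))).
  have := iso r; rewrite (alternatingE r co).
  have := coherent_resolve (cdart r bot_left) co.
  have := coherent_resolve (cdart r top_right) co; rewrite !resolve_cdart.
  have := coherent_resolve (cdart r bot_right) co; rewrite !resolve_cdart.
  by case: (a r); do 4!case: (o _).
split; last by apply/ffunP => r; rewrite ffunE !H.
apply/link_orientationsP => d; split; first exact: coherent_glue co.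
case: d => [[[r i]|x]|x];
  [|exact: (coherent_resolve (inl (inr x)) co)|exact: (coherent_resolve (inr x) co)].
rewrite -/(cdart r i) /= -/(cdart r (opp4 i)).
by case: (ord4P i) => ->; rewrite opp4E !H ?negbK.
Qed.

End LinkOrientations.

(** * From sectors to homology *)

Section HomologyLift.
Local Open Scope quotient_scope.
Variables (R : pzRingType) (U V W : lmodType R).
Variables (f : {linear U -> V}) (g : {linear V -> W}).

Definition hclass (z : cycles g) : homology f g := \pi_(homology f g) z.

Lemma hclass_repr (x : homology f g) : hclass (repr x) = x.
Proof. exact: reprK. Qed.

Lemma hclassP (c : R) (z z' : cycles g) : hclass (c *: z + z') = c *: hclass z + hclass
  z'.
Proof. by rewrite /hclass homology_piD -homology_pi_scale. Qed.

Lemma hclass_eq0 (z : cycles g) : (exists y, f y = cycle_val z) -> hclass z = 0.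
Proof.
move=> bz; have : \pi_(homology f g) z == \pi_(homology f g) 0.
  by rewrite -Quotient.idealrBE subr0 unfold_in; apply/asboolP.
move/eqP; rewrite -/(hclass z) => ->; apply: (addrI (\pi_(homology f g) 0)).
by rewrite -homology_piD !addr0.
Qed.

Lemma cycle_valP (z : cycles g) : g (cycle_val z) = 0.
Proof. by case: z => v /= /eqP. Qed.

Variable phi : V -> R.
Hypotheses (phi_lin : forall c x y, phi (c *: x + y) = c * phi x + phi y)
  (phi_f : forall y, phi (f y) = 0).

Lemma hclass_phi (z : cycles g) : phi (cycle_val (repr (hclass z))) = phi (cycle_val z).
Proof.
have : \pi_(homology f g) (repr (hclass z)) == \pi_(homology f g) z by rewrite reprK.
rewrite -Quotient.idealrBE unfold_in => /asboolP[y fy].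
have -> : cycle_val (repr (hclass z)) = 1 *: f y + cycle_val z.
  by rewrite scale1r fy /= subrK.
by rewrite phi_lin phi_f mulr0 add0r.
Qed.

Lemma phi_repr_linear (c : R) (x y : homology f g) :
  phi (cycle_val (repr (c *: x + y)))
  = c * phi (cycle_val (repr x)) + phi (cycle_val (repr y)).
Proof.
rewrite -{1}[x]hclass_repr -{1}[y]hclass_repr -hclassP hclass_phi.
exact: phi_lin.
Qed.

End HomologyLift.

(** * Homogeneous chains as functions on all generators *)

Section Chains.
Variables (D : vlink) (ch : choices D) (R : comPzRingType).
Implicit Types (a b : vertex D) (k l : int) (X : generator ch -> R).

Definition extend k (x : chain ch R k) (g : generator ch) : R :=
  if insub g is Some u then x u else 0.

Definition restrict k X : chain ch R k := [ffun u => X (val u)].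

Lemma extend_val k (x : chain ch R k) u : extend x (val u) = x u.
Proof. by rewrite /extend valK. Qed.

Lemma extend_out k (x : chain ch R k) g : degree g != k -> extend x g = 0.
Proof. by move=> gk; rewrite /extend insubN. Qed.

Lemma extend_restrict k X g : extend (restrict k X) g = if degree g == k then X g else 0.
Proof.
rewrite /extend; case: insubP => [u gk <-|/negPf-> //].
by rewrite ffunE; case: u gk => /= g' ->.
Qed.

Lemma degree_flip a r (v : word ch a) (w : word ch (flip a r)) : ~~ a r ->
  degree (Tagged (word ch) w) = degree (Tagged (word ch) v) + 1.
Proof.
move=> ar; rewrite /degree /= /weight addrAC; congr (_ - _).
have -> : [set s | flip a r s] = r |: [set s | a s].
  by apply/setP => s; rewrite !inE ffunE.
by rewrite cardsU1 inE ar addnC PoszD.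
Qed.

Lemma d_coef_degree (g h : generator ch) : degree h != degree g + 1 -> d_coef R g h = 0.
Proof.
move=> gh; apply: big_pred0 => r; apply: contraNF gh;
  case: g h => a v [b w] /= /andP[ar /eqP eb].
by move: w; rewrite eb => w; rewrite (degree_flip v w ar).
Qed.

Lemma boundary_extend k (x : chain ch R k) h :
  boundary (extend x) h = \sum_(u : generator_in ch k) x u * d_coef R (val u) h.
Proof.
rewrite /boundary (bigID (fun g => degree g == k)) /= [X in _ + X]big1 ?addr0; last first.
  by move=> g gk; rewrite extend_out // mul0r.
rewrite (reindex_omap (val : generator_in ch k -> _) insub) /=; last first.
  by move=> g gk; rewrite insubT.
apply: eq_big => u; first by rewrite valK eqxx andbT (valP u).
by rewrite extend_val.
Qed.

Lemma boundary_degree X X' h : (forall g, degree h = degree g + 1 -> X g = X' g) ->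
  boundary X h = boundary X' h.
Proof.
move=> XX'; apply: eq_bigr => g _; case: (eqVneq (degree h) (degree g + 1)) =>
  [/XX'->//|gh].
by rewrite d_coef_degree ?mulr0.
Qed.

Lemma boundary_extend_out k (x : chain ch R k) h : degree h != k + 1 -> boundary
  (extend x) h = 0.
Proof.
move=> hk; rewrite boundary_extend big1 // => u _; rewrite d_coef_degree ?mulr0 //.
by case: u => g /= /eqP->.
Qed.

Lemma extend_differential k l (x : chain ch R k) : l = k + 1 ->
  extend (differential l x) = boundary (extend x).
Proof.
move=> lk; apply: funext => h; case: (boolP (degree h == l)) => hl.
  have -> : h = val (Sub h hl : generator_in ch l) by rewrite SubK.
  by rewrite extend_val ffunE boundary_extend.
by rewrite extend_out // boundary_extend_out // -lk.
Qed.

Lemma extendP k (c : R) (x y : chain ch R k) g :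
  extend (c *: x + y) g = c * extend x g + extend y g.
Proof.
by rewrite /extend; case: insub => [u|]; rewrite ?ffunE // mulr0 addr0.
Qed.

Lemma color_coord_extendP k (c : R) (x y : chain ch R k) a o :
  color_coord (extend (c *: x + y)) a o = c * color_coord (extend x) a o + color_coord
    (extend y) a o.
Proof.
rewrite /color_coord mulr_sumr -big_split; apply: eq_bigr => v _ /=.
by rewrite extendP mulrDl mulrA.
Qed.

Lemma color_coord_extend_out k (x : chain ch R k) a o :
  (weight a)%:Z - (nminus D)%:Z != k -> color_coord (extend x) a o = 0.
Proof. by move=> ak; rewrite /color_coord big1 // => v _;
  rewrite extend_out // mul0r. Qed.

End Chains.

Section Total.
Local Open Scope quotient_scope.
Variables (D : vlink) (ch : choices D) (R : comPzRingType).
Hypothesis reg2 : forall x : R, 2%:R * x = 0 -> x = 0.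
Local Notation n := (2 ^ ncomponents D)%N.
Local Notation total := (total_Lee_homology ch R).
Local Notation deg i := (i%:Z - (nminus D)%:Z).

Definition sector (j : 'I_n) : {ffun ldart D -> bool} :=
  enum_val (cast_ord (esym (card_link_orientations D)) j).

Lemma sector_in j : sector j \in link_orientations D.
Proof. exact: enum_valP. Qed.

Lemma sector_inj : injective sector.
Proof. by move=> i j /enum_val_inj/cast_ord_inj. Qed.

Lemma sector_surj o : o \in link_orientations D -> exists j, sector j = o.
Proof.
move=> Lo; exists (cast_ord (card_link_orientations D) (enum_rank_in Lo o)).
by rewrite /sector cast_ordK enum_rankK_in.
Qed.

Definition lee_cycle k (u : Lee_homology ch R k) : cycles (@differential D ch R k (k +
  1)) :=
  repr (u : homology (@differential D ch R (k - 1) k) (@differential D ch R k (k + 1))).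

Definition lee_class k (z : cycles (@differential D ch R k (k + 1))) : Lee_homology ch
  R k :=
  hclass (@differential D ch R (k - 1) k) z.

Definition lee_coord j k (x : chain ch R k) : R :=
  color_coord (extend x) (seifert_state (sector j)) (sector j).

Lemma lee_coordP j k (c : R) (x y : chain ch R k) :
  lee_coord j (c *: x + y) = c * lee_coord j x + lee_coord j y.
Proof. exact: color_coord_extendP. Qed.

Lemma lee_coord_boundary j k (y : chain ch R (k - 1)) : lee_coord j (differential k y)
  = 0.
Proof.
rewrite /lee_coord extend_differential ?subrK //.
apply: color_coord_boundary_isolated => //.
  exact/coherent_seifert_state/sector_in.
exact/isolated_link_orientation/sector_in.
Qed.

Lemma lee_coord_class j k (z : cycles (@differential D ch R k (k + 1))) :
  lee_coord j (cycle_val (lee_cycle (lee_class z))) = lee_coord j (cycle_val z).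
Proof.
apply: (@hclass_phi _ _ _ _ _ _ (@lee_coord j k)) => [c x y|y].
  exact: lee_coordP.
exact: lee_coord_boundary.
Qed.

Lemma lee_coord_linear j k (c : R) (u v : Lee_homology ch R k) :
  lee_coord j (cycle_val (lee_cycle (c *: u + v)))
  = c * lee_coord j (cycle_val (lee_cycle u)) + lee_coord j (cycle_val (lee_cycle v)).
Proof.
apply: (@phi_repr_linear _ _ _ _ _ _ (@lee_coord j k)) => [c' x y|y].
  exact: lee_coordP.
exact: lee_coord_boundary.
Qed.

(** Only the degree of the oriented resolution contributes to coordinate [j]; summing over all
    degrees avoids transport between degrees. *)
Definition total_coord (x : total) : {ffun 'I_n -> R^o} :=
  [ffun j => \sum_(i < (nclassical D).+1) lee_coord j (cycle_val (lee_cycle (x i)))].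

Lemma total_coord_linear : linear total_coord.
Proof.
move=> c x y; apply/ffunP => j; rewrite !ffunE scaler_sumr -big_split.
by apply: eq_bigr => i _; rewrite !ffunE lee_coord_linear.
Qed.
HB.instance Definition _ :=
  GRing.isLinear.Build R total {ffun 'I_n -> R^o} *:%R total_coord total_coord_linear.

Lemma weight_le a : (weight (a : vertex D) < (nclassical D).+1)%N.
Proof. by rewrite ltnS -[X in (_ <= X)%N]card_ord; apply: max_card. Qed.

Lemma lee_coord_out j k (x : chain ch R k) :
  deg (weight (seifert_state (sector j))) != k -> lee_coord j x = 0.
Proof. exact: color_coord_extend_out. Qed.

Lemma total_coordE j (x : total) (i : 'I_(nclassical D).+1) :
  i = weight (seifert_state (sector j)) :> nat ->
  total_coord x j = lee_coord j (cycle_val (lee_cycle (x i))).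
Proof.
move=> ij; rewrite ffunE (bigD1 i) //= big1 ?addr0 // => i' ne.
apply: lee_coord_out; apply: contra ne => /eqP/addIr[] e.
by apply/eqP/val_inj; rewrite /= ij e.
Qed.

Lemma cycle_boundary k (z : cycles (@differential D ch R k (k + 1))) h :
  boundary (extend (cycle_val z)) h = 0.
Proof.
rewrite -(extend_differential _ (erefl (k + 1))) cycle_valP /extend.
by case: insub => // u; rewrite ffunE.
Qed.

Lemma lee_cycle_torsion k (z : cycles (@differential D ch R k (k + 1))) :
  (forall j, lee_coord j (cycle_val z) = 0) ->
  2%:R ^+ (depth D).+1 *: lee_class z = 0.
Proof.
move=> z0; have [|a o co iso|Y dY] := @boundary_of_cycle _ ch R reg2 (extend (cycle_val
  z)).
- exact: cycle_boundary.
- have [Lo ->] := isolatedP co iso; have [j <-] := sector_surj Lo.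
  exact: z0.
have -> : 2%:R ^+ (depth D).+1 *: lee_class z
    = lee_class (2%:R ^+ (depth D).+1 *: z + 0).
  by rewrite /lee_class hclassP (hclass_eq0 (z := 0)) ?addr0 //; exists 0;
    rewrite linear0.
(* [Y] need not be homogeneous, but its part of degree [k - 1] has the same boundary in degree
   [k]. *)
apply: hclass_eq0; exists (restrict (k - 1) Y); apply/ffunP => u.
rewrite addr0 -extend_val extend_differential ?subrK //.
rewrite (@boundary_degree _ _ _ _ Y) => [|g gu]; last first.
  by rewrite extend_restrict ifT // -(eqP (valP u)) gu addrK.
by rewrite dY extend_val ffunE.
Qed.

Lemma total_coord_torsion (x : total) : total_coord x = 0 ->
  2%:R ^+ (depth D).+1 *: x = 0.
Proof.
move=> x0; apply/ffunP => i; rewrite !ffunE -[x i]hclass_repr.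
apply: lee_cycle_torsion => j.
case: (eqVneq (weight (seifert_state (sector j))) i) => [e|ne].
  by rewrite -(@total_coordE j x i) // x0 ffunE.
apply: lee_coord_out; apply: contra ne => /eqP/addIr[] e.
by rewrite e.
Qed.

Lemma restrict_cycle j k :
  restrict k (sector_vector R (ch:=ch) (seifert_state (sector j)) (sector j))
  \in cycle_pred (@differential D ch R k (k + 1)).
Proof.
rewrite inE; apply/eqP/ffunP => u; rewrite -extend_val extend_differential //.
rewrite (@boundary_degree _ _ _ _ (sector_vector R (seifert_state (sector j)) (sector
  j))).
  rewrite boundary_sector_vector ?ffunE //.
  exact/isolated_link_orientation/sector_in.
move=> g gu; rewrite extend_restrict ifT //.
by rewrite -(inj_eq (addIr 1)) -gu (eqP (valP u)).
Qed.

Definition sector_class j : total :=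
  [ffun i : 'I_(nclassical D).+1 => lee_class (Cycle (restrict_cycle j (deg i)))].

Lemma total_coord_sector j j' : total_coord (sector_class j) j' =
  (j' == j)%:R * 2%:R ^+ size (numbering ch (seifert_state (sector j))).
Proof.
pose i : 'I_(nclassical D).+1 := Ordinal (weight_le (seifert_state (sector j'))).
rewrite (@total_coordE j' _ i) // ffunE lee_coord_class /= /lee_coord.
transitivity (color_coord (sector_vector R (ch := ch) (seifert_state (sector j))
  (sector j))
    (seifert_state (sector j')) (sector j')).
  by apply: eq_bigr => v _; rewrite extend_restrict /degree /= eqxx.
rewrite color_coord_sector_vector; last exact/coherent_seifert_state/sector_in.
case: (eqVneq j' j) => [->|ne]; first by rewrite !eqxx.
by rewrite (inj_eq sector_inj) (negPf ne) andbF !mul0r.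
Qed.

Lemma total_coord_image j : exists x, forall j',
  total_coord x j' = (j' == j)%:R * 2%:R ^+ depth D.
Proof.
pose s := size (numbering ch (seifert_state (sector j))).
exists (2%:R ^+ (depth D - s) *: sector_class j) => j'.
rewrite linearZ ffunE total_coord_sector /=.
rewrite -[_ *: _]/(_ * _) mulrCA; congr (_ * _).
by rewrite -exprD subnK // size_numbering_le.
Qed.

Lemma total_coord_exists :
  exists (F : {linear total -> {ffun 'I_n -> R^o}}) (m : nat),
    (forall x, F x = 0 -> 2%:R ^+ m *: x = 0) /\
    (forall j, exists x, forall j', F x j' = (j' == j)%:R * 2%:R ^+ m).
Proof.
exists total_coord, (depth D).+1; split; first exact: total_coord_torsion.
(* One more factor 2, to share the exponent with the kernel. *)
move=> j; have [x Fx] := total_coord_image j; exists (2%:R *: x) => j'.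
by rewrite linearZ ffunE Fx -[_ *: _]/(_ * _) mulrCA -exprS.
Qed.

End Total.

(** * Modules up to powers of 2 *)

Section HalfIso.
Variables (R : comPzRingType) (H : lmodType R) (n m : nat) (half : R).
Variable F : {linear H -> {ffun 'I_n -> R^o}}.
Hypotheses (halfE : half * 2%:R = 1) (F_ker : forall x, F x = 0 -> 2%:R ^+ m *: x = 0).
Hypothesis F_im : forall j, exists x, forall j', F x j' = (j' == j)%:R * 2%:R ^+ m.

(** Dividing by [2 ^+ m] turns the elements given by [F_im] into a section of [F], and a kernel
    killed by a unit is zero. *)
Lemma lmod_iso_half : lmod_iso H {ffun 'I_n -> R^o}.
Proof.
have halfX : half ^+ m * 2%:R ^+ m = 1 by rewrite -exprMn halfE expr1n.
have [e Fe] := choice F_im.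
pose G (y : {ffun 'I_n -> R^o}) : H := \sum_j (half ^+ m * y j) *: e j.
have FG y : F (G y) = y.
  apply/ffunP => j; rewrite linear_sum sum_ffunE (bigD1 j) //= big1 ?addr0 => [|i ij].
    rewrite linearZ ffunE Fe eqxx mul1r -[_ *: _]/(_ * _).
    by rewrite mulrAC halfX mul1r.
  by rewrite linearZ ffunE Fe eq_sym (negPf ij) mul0r scaler0.
have F_inj x : F x = 0 -> x = 0.
  by move/F_ker => x0; rewrite -[x]scale1r -halfX -scalerA x0 scaler0.
exists F; exists G => // x; apply/eqP; rewrite -subr_eq0; apply/eqP/F_inj.
by rewrite linearB /= FG subrr.
Qed.

End HalfIso.

(** * Integral coefficients: splitting off the torsion *)

Section IntIso.
Variables (H : lmodType int) (n m : nat) (F : {linear H -> {ffun 'I_n -> int^o}}).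
Hypothesis F_ker : forall x, F x = 0 -> 2%:R ^+ m *: x = 0.
Hypothesis F_im : forall j, exists x, forall j', F x j' = (j' == j)%:R * 2%:R ^+ m.

Let frame (e : 'I_n -> H) : 'M[int]_n := \matrix_(i, j) F (e i) j.
Let value (x : H) : 'rV[int]_n := \row_j F x j.
Let cramer e (x : H) : 'rV[int]_n := value x *m \adj (frame e).

Let cramerP e c x y i :
  cramer e (c *: x + y) 0 i = c * cramer e x 0 i + cramer e y 0 i.
Proof.
transitivity ((c *: cramer e x + cramer e y) 0 i); last by rewrite mxE [X in X + _]mxE.
congr (fun_of_matrix _ 0 i); rewrite /cramer scalemxAl -mulmxDl; congr (_ *m _).
by apply/rowP => j; rewrite !mxE linearP !ffunE.
Qed.

Let cramer_frame e i k : cramer e (e i) 0 k = \det (frame e) * (k == i)%:R.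
Proof.
have -> : cramer e (e i) = row i (frame e *m \adj (frame e)).
  by rewrite row_mul; congr (_ *m _); apply/rowP => j; rewrite !mxE.
by rewrite mul_mx_adj !mxE mulr_natr eq_sym.
Qed.

Let det_replace e i x :
  \det (frame (fun k => if k == i then x else e k)) = cramer e x 0 i.
Proof.
rewrite (expand_det_row _ i) mxE; apply: eq_bigr => j _; rewrite !mxE eqxx.
congr (_ * ((-1) ^+ _ * \det _)); apply/matrixP => k l; rewrite !mxE.
by rewrite eq_sym (negPf (neq_lift _ _)).
Qed.

(* A frame whose determinant is nonzero of least absolute value is a basis of
   the image of F: by Euclidean division of a Cramer determinant, an element
   outside its span would replace a row and decrease the determinant. *)
Let frame_exists : exists e : 'I_n -> H, \det (frame e) != 0 /\
  forall x i, (\det (frame e) %| cramer e x 0%R i)%Z.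
Proof.
pose P d := `[< exists e, \det (frame e) != 0 /\ `|\det (frame e)|%N = d >].
have exP : exists d, P d.
  have [e Fe] := choice F_im; exists `|\det (frame e)|%N; apply/asboolP; exists e;
    split=> //.
  have -> : frame e = (2%:R ^+ m)%:M.
    by apply/matrixP => i j; rewrite !mxE Fe mulr_natl eq_sym.
  by rewrite det_scalar !expf_neq0.
case: (ex_minnP exP) => d /asboolP[e [e0 ed]] dmin; exists e; split=> // x i.
apply/dvdz_mod0P/eqP; apply: contraT => rem0.
set D := \det (frame e) in e0 ed rem0 *; set c := cramer e x 0 i in rem0 *.
(* Subtracting a multiple of [e i] reduces the Cramer determinant modulo [D]. *)
pose x' := (- (c %/ D)%Z) *: e i + x.
have x'E : cramer e x' 0 i = (c %% D)%Z.
  rewrite cramerP cramer_frame eqxx mulr1 -/c -/D mulNr addrC.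
  by rewrite {1}(divz_eq c D) addrC addKr.
have /dmin : P `|(c %% D)%Z|%N.
  apply/asboolP; exists (fun k => if k == i then x' else e k).
  by rewrite det_replace x'E.
rewrite leqNgt => /negP[]; rewrite -ed -ltz_nat !abszE.
by rewrite (ger0_norm (modz_ge0 _ e0)) ltz_mod.
Qed.

(** [g] gives the coordinates of [F x] in the minimal frame, and [span] is a section of it. So [H]
    is the direct sum of a free module and the kernel of [g], which lies in the torsion kernel of
    [F]. *)
Lemma lmod_iso_int : exists T : lmodType int,
  (forall t : T, exists k : nat, (0 < k)%N /\ t *+ k = 0) /\
  lmod_iso H ({ffun 'I_n -> int^o} * T)%type.
Proof.
have [e [e0 div_e]] := frame_exists; set D := \det (frame e) in e0 div_e.
pose g (x : H) : {ffun 'I_n -> int^o} := [ffun i => (cramer e x 0%R i %/ D)%Z].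
have gE x i : g x i * D = cramer e x 0 i by rewrite ffunE divzK.
have g_lin : linear g.
  move=> c x y; apply/ffunP => i; apply: (mulIf e0).
  rewrite gE cramerP ffunE [X in _ = (X + _) * _]ffunE mulrDl gE.
  by rewrite -[_ *: _]/(_ * _) -mulrA gE.
pose gl : {linear H -> {ffun 'I_n -> int^o}} :=
  HB.pack g (GRing.isLinear.Build int H {ffun 'I_n -> int^o} *:%R g g_lin).
have gZ c x : g (c *: x) = c *: g x by rewrite -[g (c *: x)]/(gl (c *: x)) linearZ.
have ge i j : g (e i) j = (j == i)%:R.
  by apply: (mulIf e0); rewrite gE cramer_frame mulrC.
have g_ker x : g x = 0 -> F x = 0.
  move=> gx; have c0 : cramer e x = 0.
    by apply/rowP => i; rewrite -gE gx ffunE mul0r mxE.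
  have /rowP v0 : D *: value x = 0.
    by rewrite -mul_mx_scalar -mul_adj_mx mulmxA [value x *m _]c0 mul0mx.
  apply/ffunP => j; have := v0 j; rewrite !mxE ffunE => /eqP.
  by rewrite mulf_eq0 (negPf e0) => /eqP.
pose span (y : {ffun 'I_n -> int^o}) : H := \sum_j y j *: e j.
have span_lin c y z : span (c *: y + z) = c *: span y + span z.
  rewrite /span scaler_sumr -big_split; apply: eq_bigr => j _ /=.
  by rewrite !ffunE scalerDl scalerA.
have g_span y : g (span y) = y.
  rewrite -[g _]/(gl _) linear_sum; apply/ffunP => j; rewrite sum_ffunE (bigD1 j) //=.
  rewrite big1 ?addr0 => [|i ij]; rewrite gZ [LHS]ffunE ge.
    by rewrite eqxx -[_ *: _]/(_ * _) mulr1.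
  by rewrite eq_sym (negPf ij) scaler0.
have tors_proof x : x - span (g x) \in cycle_pred gl.
  by rewrite inE linearB /= g_span subrr.
pose phi (x : H) : ({ffun 'I_n -> int^o} * cycles gl)%type := (g x, Cycle (tors_proof x)).
have phi_lin : linear phi.
  move=> c x y; congr (_, _); first exact: g_lin.
  apply: val_inj; rewrite /= g_lin span_lin scalerBr.
  by rewrite opprD addrACA.
(* [cycles gl] serves as the kernel of [gl] with its module structure. *)
exists (cycles gl); split.
  move=> t; exists (2 ^ m)%N; split; first by rewrite expn_gt0.
  apply: val_inj; rewrite raddfMn /= -scaler_nat natrX.
  by apply/F_ker/g_ker; case: t => v /= /eqP.
pose phil : {linear H -> ({ffun 'I_n -> int^o} * cycles gl)%type} :=
  HB.pack phi (GRing.isLinear.Build int H _ *:%R phi phi_lin).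
exists phil; exists (fun yt => span yt.1 + cycle_val yt.2) => [x|[y t]] /=.
  by rewrite addrC subrK.
have gt : g (cycle_val t) = 0 by case: t => v /= /eqP.
have gy : g (span y + cycle_val t) = y.
  by rewrite -[g _]/(gl _) linearD /= g_span gt addr0.
rewrite /phi; congr (_, _); first exact: gy.
by apply: val_inj; rewrite /= gy addrC addKr.
Qed.

(** Integer coordinates are torsion-free, so [F] kills [x] and [2 ^ m] annihilates it; Euclidean
    division by the minimal [k] leaves no remainder. *)
Lemma has_order_pow2 (x : H) k : has_order x k -> exists j, k = (2 ^ j)%N.
Proof.
case=> k0 xk kmin; have Fx : F x = 0.
  apply/ffunP => j; have /(congr1 (fun y => F y j)) := xk.
  rewrite raddfMn /= linear0 ffunMnE !ffunE => /eqP.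
  by rewrite mulrn_eq0 eqn0Ngt k0 => /eqP.
have x2 : x *+ (2 ^ m) = 0 by rewrite -scaler_nat natrX F_ker.
suff /(@dvdn_pfactor _ _ m (isT : prime 2)) [j _ ->] : (k %| 2 ^ m)%N by exists j.
apply/eqP; apply: contraTeq (ltn_pmod (2 ^ m) k0); rewrite -lt0n -leqNgt => r0.
apply: kmin => //; move: x2; rewrite {1}(divn_eq (2 ^ m) k) mulrnDr mulnC mulrnA xk.
by rewrite mul0rn add0r.
Qed.

End IntIso.

Lemma half_int_half : exists h : half_int, h * 2%:R = 1.
Proof.
have halfP : (1 / 2%:R : rat) \in half_int_pred.
  by rewrite unfold_in; apply/asboolP; exists 1, 1%N; rewrite expr1.
exists (HalfInt halfP); apply: val_inj.
by rewrite rmorphM rmorph1 rmorph_nat /= divfK.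
Qed.

Lemma half_regular (R : comPzRingType) (h x : R) : h * 2%:R = 1 -> 2%:R * x = 0 -> x = 0.
Proof. by move=> h2 x2; rewrite -[x]mul1r -h2 -mulrA x2 mulr0. Qed.

Lemma Lee_homology_half (D : vlink) (ch : choices D) (R : comPzRingType) (h : R) :
  h * 2%:R = 1 ->
  lmod_iso (total_Lee_homology ch R) {ffun 'I_(2 ^ ncomponents D) -> R^o}.
Proof.
move=> h2; have reg2 x := @half_regular R h x h2.
have [F [m [F_ker F_im]]] := total_coord_exists ch reg2.
exact: lmod_iso_half h2 F_ker F_im.
Qed.

Theorem proposition3p11 (D : vlink) (ch : choices D) :
  [/\ exists T : lmodType int,
        (forall t : T, exists k : nat, (0 < k)%N /\ t *+ k = 0) /\
        lmod_iso (total_Lee_homology ch int)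
          ({ffun 'I_(2 ^ ncomponents D) -> int^o} * T)%type,
      lmod_iso (total_Lee_homology ch rat)
        {ffun 'I_(2 ^ ncomponents D) -> rat^o} /\
      lmod_iso (total_Lee_homology ch half_int)
        {ffun 'I_(2 ^ ncomponents D) -> half_int^o}
    & forall (x : total_Lee_homology ch int) (k : nat),
        has_order x k -> exists j : nat, k = (2 ^ j)%N].
Proof.
have [h h2] := half_int_half.
have reg2 (x : int) : 2%:R * x = 0 -> x = 0 by move/eqP; rewrite mulf_eq0 => /eqP.
have [F [m [F_ker F_im]]] := total_coord_exists ch reg2.
split; first exact: lmod_iso_int F_ker F_im.
  split; last exact: Lee_homology_half h2.
  by apply: (@Lee_homology_half _ _ _ (2%:R^-1 : rat)); rewrite mulVf.
by move=> x k; apply: has_order_pow2 F_ker _ _.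
Qed.
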